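(* Let $\beta_0>\beta_1>\beta_2>\cdots$ be the zeros of $\psi_G$ (the logarithmic derivative of the Barnes $G$ function). Then $$\sum_{k=0}^\infty\frac{1}{\beta_k^2}=\frac94+\frac{\pi^2}{2}+\gamma(1+\gamma+\log 2\pi)-\frac12\log 2\pi+\frac14\log^2 2\pi,$$ where $\gamma$ is the Euler constant, $\log 2\pi=\log(2\pi)$ and $\log^2 2\pi=(\log(2\pi))^2$.
   Context: $\Gamma$ is the Euler gamma function and $\psi=\Gamma'/\Gamma$ is the Digamma function. The Barnes $G$ function satisfies $G(z+1)=\Gamma(z)G(z)$ with $G(1)=1$, and its logarithmic derivative is $$\psi_G(z)=\frac{G'(z)}{G(z)}=\frac{\log(2\pi)+1}{2}-z+(z-1)\psi(z)\quad(z\in\mathbb C\setminus\{0,-1,-2,\dots\}).$$ The function $\psi_G$ has first order poles at the non-positive integers; its zeros are real of multiplicity one, and exactly two of them are positive. They are enumerated in decreasing order: $\beta_0=2.55766\dots$, $\beta_1=1.39147\dots$, $\beta_2=-0.3662934\dots$, and so on. *)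

(* Defs.v *)
(* Stdlib reals with Coquelicot: limits, series and the complex numbers. *)
From Stdlib Require Import Reals.
From Coquelicot Require Import Coquelicot.
Open Scope R_scope.

Definition euler_gamma : R :=
  real (Lim_seq (fun n : nat => sum_n_m (fun k : nat => / INR k) 1 n - ln (INR n))).

Definition Cexp (z : C) : C :=
  (exp (Re z) * cos (Im z), exp (Re z) * sin (Im z)).

(* Componentwise total limit: it is the limit in C of u whenever u converges,
   and carries no information otherwise. *)
Definition CLim_seq (u : nat -> C) : C :=
  (real (Lim_seq (fun n : nat => Re (u n))),
   real (Lim_seq (fun n : nat => Im (u n)))).

(* f 0 * ... * f (n - 1) *)
Fixpoint Cprod (f : nat -> C) (n : nat) : C :=
  match n with
  | O => RtoC 1
  | S m => Cmult (Cprod f m) (f m)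
  end.

(* Factor (1 + w/k)^k exp (w^2/(2k) - w) of the canonical product, k >= 1. *)
Definition barnes_factor (w : C) (k : nat) : C :=
  (((1 + w / INR k) ^ k) * Cexp (w ^ 2 / (2 * INR k) - w))%C.

(* Barnes' canonical product:
     G (1 + w) = (2 pi)^(w/2) exp (- (w + (1 + gamma) w^2) / 2)
                 * prod_(k >= 1) (1 + w/k)^k exp (w^2/(2k) - w).
   The functional equation and G 1 = 1 alone do not determine G; this entire
   function is the standard solution, the one with the logarithmic derivative
     (log (2 pi) + 1)/2 - z + (z - 1) psi z. *)
Definition BarnesG (z : C) : C :=
  let w := (z - 1)%C in
  (Cexp (w / 2 * ln (2 * PI))
   * Cexp (- (w + (1 + euler_gamma) * w ^ 2) / 2)
   * CLim_seq (Cprod (fun j : nat => barnes_factor w (S j))))%C.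

(* C_derive takes the limit of the difference quotient along the horizontal
   line through z; as BarnesG is entire this is its complex derivative. *)
Definition psiG (z : C) : C := (C_derive BarnesG z / BarnesG z)%C.

Definition nonpos_int (z : C) : Prop := exists n : nat, z = RtoC (- INR n).

(* The non-positive integers are poles of psiG, where the total division above
   returns a meaningless value; they are excluded from the zeros. *)
Definition psiG_zero (z : C) : Prop := ~ nonpos_int z /\ psiG z = RtoC 0.

(* Main.v *)
Require Import Defs.
From Stdlib Require Import Reals Lra Lia.
From Stdlib Require Import ClassicalEpsilon.
From Coquelicot Require Import Coquelicot.
Open Scope R_scope.

(** On the real line, with [j >= 0],
      [psi_G z = (log (2 pi) - 1)/2 - (1 + gamma) (z - 1) + (z - 1)^2 sum_j 1/((j + 1) (z + j))].
    It has two zeros [q < p] to the right of 1.  Its second divided difference at [z, p, q] gives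
      [psi_G z = (z - p) (z - q) S z],  [S z = sum_j r_j/(z + j)],
      [r_j = (j + 1)/((j + p) (j + q)) > 0],
    so [S] decreases between consecutive poles, and every gap between them contains exactly one
    further zero.
    For the sum truncated to [N] poles, [z S_N z prod_(1 <= j < N) (1 + z/j)] is a polynomial whose
    zeros are one in each gap; comparing second-order expansions at 0 gives the sum of the
    [1/zeta^2] over them.  These zeros increase with [N] towards those of [S], so the sums converge
    monotonically.  The expansion of [z psi_G z] at 0 then evaluates the limit, with
    [sum_(j >= 1) 1/j^2 = pi^2/6]. *)

(** The residue of [psi_G] at [-j] is [j + 1], so its partial fractions converge only after an
    affine correction, which hides both the sign and the monotonicity between poles. Dividing by
    [(z - p) (z - q)] cures both at once: the residues stay positive, decay like [1/j], and no
    polynomial part is left. Truncation stands in for a Hadamard factorisation of the entire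
    function behind [S]. For finitely many poles the factorisation over the zeros is plain algebra,
    and only power sums, not products, have to pass to the limit. The term [pi^2/2] has two sources:
    the factors [1 + z/j] that clear the poles contribute [pi^2/6], and the expansion of [z psi_G z]
    at 0 contributes [2 pi^2/6]. All the analysis is real. The hypothesis on [beta] already places
    every zero on the real line, so the complex definitions matter only through their restriction to
    it. *)

(** * Finite sums and their relation to series *)

Fixpoint Psum (u : nat -> R) (n : nat) : R :=
  match n with O => 0 | S m => Psum u m + u m end.

Fixpoint Pprod (u : nat -> R) (n : nat) : R :=
  match n with O => 1 | S m => Pprod u m * u m end.

Lemma Psum_ext (u v : nat -> R) (n : nat) :
  (forall k, (k < n)%nat -> u k = v k) -> Psum u n = Psum v n.
Proof.
  induction n as [|n IH]; intros H; simpl; [reflexivity|].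
  rewrite IH by (intros; apply H; lia). rewrite H by lia. reflexivity.
Qed.

Lemma Psum_le (u v : nat -> R) (n : nat) :
  (forall k, (k < n)%nat -> u k <= v k) -> Psum u n <= Psum v n.
Proof.
  induction n as [|n IH]; intros H; simpl; [lra|].
  apply Rplus_le_compat; [apply IH; intros; apply H; lia | apply H; lia].
Qed.

Lemma Psum_plus (u v : nat -> R) (n : nat) :
  Psum (fun k => u k + v k) n = Psum u n + Psum v n.
Proof. induction n as [|n IH]; simpl; [ring|rewrite IH; ring]. Qed.

Lemma Psum_scal (c : R) (u : nat -> R) (n : nat) :
  Psum (fun k => c * u k) n = c * Psum u n.
Proof. induction n as [|n IH]; simpl; [ring|rewrite IH; ring]. Qed.

Lemma Psum_const (c : R) (n : nat) : Psum (fun _ => c) n = INR n * c.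
Proof. induction n as [|n IH]; [simpl; ring|]. rewrite S_INR. simpl. rewrite IH. ring. Qed.

Lemma Psum_app (u : nat -> R) (m n : nat) :
  Psum u (m + n) = Psum u m + Psum (fun k => u (m + k)%nat) n.
Proof.
  induction n as [|n IH]; simpl; [rewrite Nat.add_0_r; ring|].
  rewrite Nat.add_succ_r. simpl. rewrite IH. ring.
Qed.

Lemma Psum_incr_1 (u : nat -> R) (n : nat) :
  Psum u (S n) = u O + Psum (fun k => u (S k)) n.
Proof. change (S n) with (1 + n)%nat. rewrite Psum_app. simpl. ring. Qed.

Lemma Psum_rev (u : nat -> R) (n : nat) :
  Psum u n = Psum (fun k => u (n - 1 - k)%nat) n.
Proof.
  induction n as [|n IH]; [reflexivity|].
  rewrite (Psum_incr_1 (fun k => u (S n - 1 - k)%nat)).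
  replace (S n - 1 - 0)%nat with n by lia.
  cbn [Psum]. rewrite IH, Rplus_comm. f_equal.
  apply Psum_ext. intros k Hk. f_equal. lia.
Qed.

Lemma Psum_ge_0 (u : nat -> R) (n : nat) : (forall k, 0 <= u k) -> 0 <= Psum u n.
Proof. intros H. induction n as [|n IH]; simpl; [lra|]. specialize (H n). lra. Qed.

Lemma Psum_mono (u : nat -> R) (m n : nat) :
  (forall k, 0 <= u k) -> (m <= n)%nat -> Psum u m <= Psum u n.
Proof.
  intros H Hmn. replace n with (m + (n - m))%nat by lia. rewrite Psum_app.
  pose proof (Psum_ge_0 (fun k => u (m + k)%nat) (n - m) (fun k => H _)). lra.
Qed.

Lemma sum_n_Psum (u : nat -> R) (n : nat) : sum_n u n = Psum u (S n).
Proof.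
  induction n as [|n IH]; [rewrite sum_O; simpl; ring|].
  rewrite sum_Sn, IH. reflexivity.
Qed.

Lemma is_series_Psum (u : nat -> R) (l : R) : is_series u l <-> is_lim_seq (Psum u) l.
Proof.
  rewrite (is_lim_seq_incr_1 (Psum u)).
  split; intros H.
  - apply is_lim_seq_ext with (sum_n u); [intros n; apply sum_n_Psum|exact H].
  - change (is_lim_seq (sum_n u) l).
    apply is_lim_seq_ext with (2 := H). intros n; symmetry; apply sum_n_Psum.
Qed.

Lemma Series_Psum (u : nat -> R) : ex_series u -> is_lim_seq (Psum u) (Series u).
Proof. intros H. apply is_series_Psum, Series_correct, H. Qed.

Lemma Series_of_lim (u : nat -> R) (l : R) : is_lim_seq (Psum u) l -> Series u = l.
Proof. intros H. apply is_series_unique, is_series_Psum, H. Qed.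

Lemma Psum_le_Series (u : nat -> R) (n : nat) :
  (forall k, 0 <= u k) -> ex_series u -> Psum u n <= Series u.
Proof.
  intros H Hu. apply (is_lim_seq_incr_compare (Psum u) (Series u) (Series_Psum u Hu)).
  intros k; simpl; specialize (H k); lra.
Qed.

(** * The Basel series, from [1/sin^2 x + 1/cos^2 x = 4/sin^2 (2x)] *)

Definition invsq (j : nat) : R := / (INR j + 1) ^ 2.

Lemma invsq_pos (j : nat) : 0 < invsq j.
Proof. unfold invsq. pose proof (pos_INR j). apply Rinv_0_lt_compat. nra. Qed.

Lemma x_cos_lt_sin (x : R) : 0 < x <= PI / 2 -> x * cos x < sin x.
Proof.
  intros [H0 H1].
  (* [MVT_gen] locates its point only in the closed interval, and the derivative [t sin t] vanishes
     at 0. Cutting at [x/2] makes the growth strict on the right half and weak on the left. *)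
  destruct (MVT_gen (fun t => sin t - t * cos t) (x/2) x (fun t => t * sin t)) as [c [Hc Heq]].
  - intros t _. auto_derive; [trivial|ring].
  - intros t _. apply derivable_continuous_pt.
    apply ex_derive_Reals_0. auto_derive. trivial.
  - rewrite Rmin_left, Rmax_right in Hc by lra.
    assert (0 < sin c) by (apply sin_gt_0; pose proof PI_RGT_0; lra).
    destruct (MVT_gen (fun t => sin t - t * cos t) 0 (x/2) (fun t => t * sin t)) as [d [Hd Hed]].
    + intros t _. auto_derive; [trivial|ring].
    + intros t _. apply derivable_continuous_pt.
      apply ex_derive_Reals_0. auto_derive. trivial.
    + rewrite Rmin_left, Rmax_right in Hd by lra.
      assert (0 <= sin d) by (apply sin_ge_0; pose proof PI_RGT_0; lra).
      rewrite sin_0 in Hed.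
      assert (0 <= d * sin d) by (apply Rmult_le_pos; lra).
      assert (0 < c * sin c) by (apply Rmult_lt_0_compat; lra).
      nra.
Qed.

(** The left bound is [sin x < x]. Squaring [x cos x < sin x] gives [x^2 (1 - sin^2 x) <= sin^2 x],
    that is [x^2 <= (1 + x^2) sin^2 x], which is the right bound. *)
Lemma inv_sin_sq_bounds (x : R) :
  0 < x < PI / 2 -> / x ^ 2 <= / sin x ^ 2 <= / x ^ 2 + 1.
Proof.
  intros Hx. pose proof PI_RGT_0.
  assert (Hs : 0 < sin x) by (apply sin_gt_0; lra).
  assert (Hc : 0 < cos x) by (apply cos_gt_0; lra).
  assert (Hsx : sin x < x) by (apply sin_lt_x; lra).
  pose proof (x_cos_lt_sin x ltac:(lra)) as Ht.
  pose proof (sin2_cos2 x) as H1. unfold Rsqr in H1.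
  split.
  - apply Rinv_le_contravar; nra.
  - apply Rmult_le_reg_l with (x ^ 2 * sin x ^ 2); [apply Rmult_lt_0_compat; nra|].
    replace (x ^ 2 * sin x ^ 2 * / sin x ^ 2) with (x ^ 2) by (field; lra).
    replace (x ^ 2 * sin x ^ 2 * (/ x ^ 2 + 1)) with (sin x ^ 2 * (1 + x ^ 2)) by (field; lra).
    assert ((x * cos x) ^ 2 <= sin x ^ 2) by (apply pow_incr; nra).
    assert (cos x * cos x = 1 - sin x * sin x) by lra.
    assert ((x * cos x) ^ 2 = x ^ 2 * (1 - sin x * sin x))
      by (replace ((x * cos x) ^ 2) with (x ^ 2 * (cos x * cos x)) by ring; rewrite H2; ring).
    nra.
Qed.

Definition odd_angle (n k : nat) : R := (2 * INR k + 1) * PI / (4 * 2 ^ n).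

Lemma pow2_INR (n : nat) : INR (2 ^ n) = 2 ^ n.
Proof. rewrite pow_INR. reflexivity. Qed.

Lemma odd_angle_bounds (n k : nat) : (k < 2 ^ n)%nat -> 0 < odd_angle n k < PI / 2.
Proof.
  intros H. unfold odd_angle. pose proof PI_RGT_0.
  assert (Hk : INR k + 1 <= 2 ^ n) by (rewrite <- S_INR, <- pow2_INR; apply le_INR; lia).
  pose proof (pos_INR k).
  assert (0 < 2 ^ n) by lra.
  split.
  - apply Rdiv_lt_0_compat; nra.
  - apply Rmult_lt_reg_r with (4 * 2 ^ n); [lra|].
    unfold Rdiv at 1. rewrite Rmult_assoc, Rinv_l by lra. nra.
Qed.

(** Reflection in [PI/4] pairs the angles of level [n + 1]. Each pair [x], [PI/2 - x] contributes
    [1/sin^2 x + 1/cos^2 x = 4/sin^2 (2x)], and [2x] is an angle of level [n], so the sum is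
    multiplied by 4. *)
Lemma odd_angle_sum (n : nat) :
  Psum (fun k => / sin (odd_angle n k) ^ 2) (2 ^ n) = 2 * (2 ^ n) ^ 2.
Proof.
  induction n as [|n IH].
  - simpl. unfold odd_angle. simpl.
    replace ((2 * 0 + 1) * PI / (4 * 1)) with (PI / 4) by field.
    rewrite sin_PI4.
    assert (0 < sqrt 2) by (apply sqrt_lt_R0; lra).
    assert (Hs : sqrt 2 * sqrt 2 = 2) by (apply sqrt_sqrt; lra).
    replace (1 / sqrt 2 * (1 / sqrt 2 * 1)) with (/ (sqrt 2 * sqrt 2)) by (field; lra).
    rewrite Hs. field.
  - replace (2 ^ S n)%nat with (2 ^ n + 2 ^ n)%nat by (simpl; lia).
    rewrite Psum_app.
    rewrite (Psum_rev (fun k => / sin (odd_angle (S n) (2 ^ n + k)) ^ 2)).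
    rewrite <- Psum_plus.
    rewrite Psum_ext with (v := fun k => 4 * / sin (odd_angle n k) ^ 2).
    + rewrite Psum_scal, IH. simpl. ring.
    + intros k Hk.
      assert (H2 : 0 < 2 ^ n) by (apply pow_lt; lra).
      replace (odd_angle (S n) (2 ^ n + (2 ^ n - 1 - k))) with (PI / 2 - odd_angle (S n) k).
      2:{ unfold odd_angle. rewrite plus_INR, 2!minus_INR by lia.
          rewrite pow2_INR. simpl. field. lra. }
      replace (odd_angle n k) with (2 * odd_angle (S n) k)
        by (unfold odd_angle; simpl; field; lra).
      assert (Hb : 0 < odd_angle (S n) k < PI / 2)
        by (apply odd_angle_bounds; simpl; lia).
      rewrite sin_2a, sin_shift.
      set (x := odd_angle (S n) k) in *.
      pose proof PI_RGT_0.
      assert (Hs : 0 < sin x) by (apply sin_gt_0; lra).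
      assert (Hc : 0 < cos x) by (apply cos_gt_0; lra).
      pose proof (sin2_cos2 x) as H1. unfold Rsqr in H1.
      replace (/ sin x ^ 2 + / cos x ^ 2)
        with ((sin x * sin x + cos x * cos x) / (sin x ^ 2 * cos x ^ 2)) by (field; lra).
      rewrite H1. field. lra.
Qed.

Definition oddsq (k : nat) : R := / (2 * INR k + 1) ^ 2.

Lemma oddsq_pos (k : nat) : 0 < oddsq k.
Proof. unfold oddsq. pose proof (pos_INR k). apply Rinv_0_lt_compat. nra. Qed.

(** Replacing [1/sin^2] by [1/x^2] costs at most 1 in each of the [2^n] terms, against a total of
    order [4^n]; after rescaling the error is of order [2^-n]. *)
Lemma oddsq_Psum_bounds (n : nat) :
  PI ^ 2 / 8 - PI ^ 2 / 16 * / 2 ^ n <= Psum oddsq (2 ^ n) <= PI ^ 2 / 8.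
Proof.
  pose proof PI_RGT_0 as HP.
  assert (H2 : 0 < 2 ^ n) by (apply pow_lt; lra).
  pose proof (odd_angle_sum n) as Hs.
  assert (Hx : Psum (fun k => / odd_angle n k ^ 2) (2 ^ n)
     = 16 * (2 ^ n) ^ 2 / PI ^ 2 * Psum oddsq (2 ^ n)).
  { rewrite <- Psum_scal. apply Psum_ext. intros k Hk. unfold odd_angle, oddsq.
    pose proof (pos_INR k). field. repeat split; lra. }
  assert (L : Psum (fun k => / odd_angle n k ^ 2) (2 ^ n)
              <= Psum (fun k => / sin (odd_angle n k) ^ 2) (2 ^ n)).
  { apply Psum_le. intros k Hk. apply inv_sin_sq_bounds, odd_angle_bounds, Hk. }
  assert (U : Psum (fun k => / sin (odd_angle n k) ^ 2) (2 ^ n)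
              <= Psum (fun k => / odd_angle n k ^ 2 + 1) (2 ^ n)).
  { apply Psum_le. intros k Hk. apply inv_sin_sq_bounds, odd_angle_bounds, Hk. }
  rewrite Psum_plus, Psum_const, pow2_INR in U.
  rewrite Hs in L, U. rewrite Hx in L, U.
  set (O := Psum oddsq (2 ^ n)) in *. set (M := 2 ^ n) in *.
  assert (HO : O = PI ^ 2 / (16 * M ^ 2) * (16 * M ^ 2 / PI ^ 2 * O)) by (field; lra).
  assert (Hc : 0 < PI ^ 2 / (16 * M ^ 2)) by (apply Rdiv_lt_0_compat; nra).
  split.
  - replace (PI ^ 2 / 8 - PI ^ 2 / 16 * / M) with (PI ^ 2 / (16 * M ^ 2) * (2 * M ^ 2 - M))
      by (field; lra).
    rewrite HO. apply Rmult_le_compat_l; lra.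
  - replace (PI ^ 2 / 8) with (PI ^ 2 / (16 * M ^ 2) * (2 * M ^ 2)) by (field; lra).
    rewrite HO. apply Rmult_le_compat_l; lra.
Qed.

Lemma le_pow2 (n : nat) : (n <= 2 ^ n)%nat.
Proof. apply Nat.lt_le_incl, Nat.pow_gt_lin_r. lia. Qed.

Lemma Psum_invsq_double (n : nat) :
  Psum invsq (2 * n) = Psum oddsq n + / 4 * Psum invsq n.
Proof.
  induction n as [|n IH]; [simpl; ring|].
  replace (2 * S n)%nat with (S (S (2 * n))) by lia.
  cbn [Psum]. rewrite IH.
  unfold invsq, oddsq. rewrite S_INR, mult_INR. change (INR 2) with 2.
  pose proof (pos_INR n). field. lra.
Qed.

Lemma basel : is_series invsq (PI ^ 2 / 6).
Proof.
  pose proof PI_RGT_0 as HP.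
  (* With [A] the partial sum, monotonicity and the splitting by parity give [A <= PI^2/8 + A/4]. In
     the limit the same relation becomes an equality and fixes the value. *)
  assert (Hbd : forall n, Psum invsq n <= PI ^ 2 / 6).
  { intros n.
    assert (H1 : Psum invsq n <= Psum invsq (2 * n))
      by (apply Psum_mono; [intros; apply Rlt_le, invsq_pos|lia]).
    rewrite Psum_invsq_double in H1.
    assert (H2 : Psum oddsq n <= Psum oddsq (2 ^ n))
      by (apply Psum_mono; [intros; apply Rlt_le, oddsq_pos|apply le_pow2]).
    pose proof (oddsq_Psum_bounds n). lra. }
  destruct (ex_finite_lim_seq_incr (Psum invsq) (PI ^ 2 / 6)) as [l Hl].
  { intros n. simpl. pose proof (invsq_pos n). lra. }
  { exact Hbd. }
  assert (Hsub : filterlim (fun n => 2 ^ n)%nat eventually eventually).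
  { intros P [N HN]. exists N. intros n Hn. apply HN. pose proof (le_pow2 n). lia. }
  assert (Hsub2 : filterlim (fun n => 2 * 2 ^ n)%nat eventually eventually).
  { intros P [N HN]. exists N. intros n Hn. apply HN. pose proof (le_pow2 n). lia. }
  assert (L1 : is_lim_seq (fun n => Psum invsq (2 ^ n)) l)
    by (apply (is_lim_seq_subseq (Psum invsq) l (fun n => 2 ^ n)%nat Hsub Hl)).
  assert (L2 : is_lim_seq (fun n => Psum invsq (2 * 2 ^ n)) l)
    by (apply (is_lim_seq_subseq (Psum invsq) l (fun n => 2 * 2 ^ n)%nat Hsub2 Hl)).
  assert (L3 : is_lim_seq (fun n => Psum oddsq (2 ^ n)) (PI ^ 2 / 8)).
  { apply is_lim_seq_le_le with (u := fun n => PI ^ 2 / 8 - PI ^ 2 / 16 * (/ 2) ^ n)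
                                (w := fun _ => PI ^ 2 / 8).
    - intros n. rewrite pow_inv. apply oddsq_Psum_bounds.
    - replace (Finite (PI ^ 2 / 8)) with (Finite (PI ^ 2 / 8 - PI ^ 2 / 16 * 0)) by (f_equal; ring).
      apply is_lim_seq_minus'; [apply is_lim_seq_const|].
      apply is_lim_seq_scal_l with (lu := 0). apply is_lim_seq_geom.
      rewrite Rabs_pos_eq; lra.
    - apply is_lim_seq_const. }
  assert (L4 : is_lim_seq (fun n => Psum invsq (2 * 2 ^ n)) (PI ^ 2 / 8 + / 4 * l)).
  { apply is_lim_seq_ext with (fun n => Psum oddsq (2 ^ n) + / 4 * Psum invsq (2 ^ n)).
    - intros n. symmetry. apply Psum_invsq_double.
    - apply is_lim_seq_plus'; [exact L3|]. apply (is_lim_seq_scal_l _ (/ 4) l L1). }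
  apply is_lim_seq_unique in L2. apply is_lim_seq_unique in L4.
  rewrite L2 in L4. injection L4 as L4.
  apply is_series_Psum. replace (PI ^ 2 / 6) with l by lra. exact Hl.
Qed.

(** * Sums of simple fractions with poles at the non-positive integers *)

Lemma ex_series_invsq_bound (u : nat -> R) (M : R) :
  (forall j, Rabs (u j) <= M * invsq j) -> ex_series u.
Proof.
  intros H. apply (@ex_series_le R_AbsRing R_CompleteNormedModule u (fun j => M * invsq j) H).
  apply (ex_series_scal_l M invsq). exists (PI ^ 2 / 6). exact basel.
Qed.

Lemma Series_invsq_bound (u : nat -> R) (M : R) :
  (forall j, Rabs (u j) <= M * invsq j) -> Rabs (Series u) <= M * (PI ^ 2 / 6).
Proof.
  intros H.
  assert (Hi : ex_series (fun j => M * invsq j))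
    by (apply (ex_series_scal_l M invsq); exists (PI ^ 2 / 6); exact basel).
  apply Rle_trans with (Series (fun j => Rabs (u j))).
  - apply Series_Rabs. apply ex_series_invsq_bound with M. intros j. rewrite Rabs_Rabsolu. apply H.
  - apply Rle_trans with (Series (fun j => M * invsq j)).
    + apply Series_le; [|exact Hi]. intros j. split; [apply Rabs_pos|apply H].
    + rewrite Series_scal_l, (is_series_unique _ _ basel). lra.
Qed.

Definition Ssum (rho : nat -> R) (z : R) : R := Series (fun j => rho j / (z + INR j)).

Definition harmonic_bound (rho : nat -> R) (M : R) : Prop :=
  0 <= M /\ forall j, Rabs (rho j) <= M / (INR j + 1).

(* Poles whose residue vanishes are harmless, because [0 / 0 = 0]. *)
Definition away (rho : nat -> R) (z d : R) : Prop :=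
  0 < d /\ forall j, rho j = 0 \/ d <= Rabs (z + INR j).

(** [j + 1 <= |z + j| + B + 1], and [|z + j| / d >= 1] lets the constant [B + 1] be absorbed into a
    multiple of [|z + j|]. *)
Lemma inv_pole_bound (z d B : R) (j : nat) :
  0 < d -> Rabs z <= B -> d <= Rabs (z + INR j) ->
  Rabs (/ (z + INR j)) <= (1 + (B + 1) / d) / (INR j + 1).
Proof.
  intros Hd HB Hz. pose proof (pos_INR j).
  assert (Hj : INR j <= Rabs (z + INR j) + B).
  { pose proof (Rle_abs (- z)). pose proof (Rle_abs (z + INR j)). rewrite Rabs_Ropp in *. lra. }
  pose proof (Rabs_pos z).
  rewrite Rabs_inv.
  apply Rmult_le_reg_l with (Rabs (z + INR j) * (INR j + 1)); [nra|].
  replace (Rabs (z + INR j) * (INR j + 1) * / Rabs (z + INR j)) with (INR j + 1) by (field; lra).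
  replace (Rabs (z + INR j) * (INR j + 1) * ((1 + (B + 1) / d) / (INR j + 1)))
    with (Rabs (z + INR j) + (B + 1) * (Rabs (z + INR j) / d)) by (field; lra).
  assert (1 <= Rabs (z + INR j) / d).
  { apply Rmult_le_reg_r with d; [lra|]. unfold Rdiv. rewrite Rmult_assoc, Rinv_l; lra. }
  nra.
Qed.

Lemma Ssum_term_bound (rho : nat -> R) (M z d B : R) (j : nat) :
  harmonic_bound rho M -> away rho z d -> Rabs z <= B ->
  Rabs (rho j / (z + INR j)) <= M * (1 + (B + 1) / d) * invsq j.
Proof.
  intros [HM Hr] [Hd Ha] HB. pose proof (invsq_pos j). pose proof (pos_INR j). pose proof (Rabs_pos z).
  assert (0 < (B + 1) / d) by (apply Rdiv_lt_0_compat; lra).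
  destruct (Ha j) as [Hz|Hz].
  - rewrite Hz. unfold Rdiv. rewrite Rmult_0_l, Rabs_R0. apply Rmult_le_pos; [|lra].
    apply Rmult_le_pos; [lra|]. unfold Rdiv in *. lra.
  - unfold Rdiv at 1. rewrite Rabs_mult.
    apply Rle_trans with (M / (INR j + 1) * ((1 + (B + 1) / d) / (INR j + 1))).
    + apply Rmult_le_compat; [apply Rabs_pos|apply Rabs_pos|apply Hr|].
      apply inv_pole_bound; assumption.
    + right. unfold invsq. field. lra.
Qed.

Lemma ex_Ssum (rho : nat -> R) (M z d : R) :
  harmonic_bound rho M -> away rho z d -> ex_series (fun j => rho j / (z + INR j)).
Proof.
  intros Hr Ha. apply ex_series_invsq_bound with (M * (1 + (Rabs z + 1) / d)).
  intros j. apply Ssum_term_bound; [assumption|assumption|lra].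
Qed.

Lemma Ssum_diff_term (rho : nat -> R) (M x y d B : R) (j : nat) :
  harmonic_bound rho M -> away rho x d -> away rho y d -> Rabs x <= B -> Rabs y <= B ->
  Rabs (rho j / (x + INR j) - rho j / (y + INR j))
    <= M * (1 + (B + 1) / d) ^ 2 * Rabs (x - y) * invsq j.
Proof.
  intros Hr [Hd Hx] [_ Hy] HBx HBy.
  pose proof (invsq_pos j). pose proof (pos_INR j). pose proof (Rabs_pos x).
  destruct Hr as [HM Hr].
  assert (0 < (B + 1) / d) by (apply Rdiv_lt_0_compat; lra).
  set (K := 1 + (B + 1) / d) in *.
  assert (HK : 0 <= M * K ^ 2) by (apply Rmult_le_pos; [lra|apply pow2_ge_0]).
  assert (Hpos : 0 <= M * K ^ 2 * Rabs (x - y) * invsq j).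
  { apply Rmult_le_pos; [|lra]. apply Rmult_le_pos; [lra|apply Rabs_pos]. }
  destruct (Hx j) as [Zx|Zx].
  - rewrite Zx. unfold Rdiv. rewrite !Rmult_0_l, Rminus_0_r, Rabs_R0. exact Hpos.
  - destruct (Hy j) as [Zy|Zy].
    + rewrite Zy. unfold Rdiv. rewrite !Rmult_0_l, Rminus_0_r, Rabs_R0. exact Hpos.
    + assert (Nx : x + INR j <> 0) by (intros E; rewrite E, Rabs_R0 in Zx; lra).
      assert (Ny : y + INR j <> 0) by (intros E; rewrite E, Rabs_R0 in Zy; lra).
      replace (rho j / (x + INR j) - rho j / (y + INR j))
        with (rho j * (/ (x + INR j) * / (y + INR j)) * - (x - y)) by (field; auto).
      rewrite !Rabs_mult, Rabs_Ropp.
      pose proof (inv_pole_bound x d B j Hd HBx Zx) as Ix.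
      pose proof (inv_pole_bound y d B j Hd HBy Zy) as Iy. fold K in Ix, Iy.
      assert (P : Rabs (rho j) * (Rabs (/ (x + INR j)) * Rabs (/ (y + INR j)))
                 <= M / (INR j + 1) * (K / (INR j + 1) * (K / (INR j + 1)))).
      { apply Rmult_le_compat; [apply Rabs_pos| |apply Hr|].
        - apply Rmult_le_pos; apply Rabs_pos.
        - apply Rmult_le_compat; auto using Rabs_pos. }
      (* The difference decays like [1/(j + 1)^3]; one factor [1/(j + 1) <= 1] is given away so that
         [invsq] majorises everything. *)
      assert (Q : M / (INR j + 1) * (K / (INR j + 1) * (K / (INR j + 1))) <= M * K ^ 2 * invsq j).
      { replace (M / (INR j + 1) * (K / (INR j + 1) * (K / (INR j + 1))))
          with (M * K ^ 2 * invsq j * / (INR j + 1)) by (unfold invsq; field; lra).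
        rewrite <- (Rmult_1_r (M * K ^ 2 * invsq j)) at 2.
        apply Rmult_le_compat_l; [apply Rmult_le_pos; lra|].
        rewrite <- Rinv_1. apply Rinv_le_contravar; lra. }
      replace (M * K ^ 2 * Rabs (x - y) * invsq j) with (M * K ^ 2 * invsq j * Rabs (x - y)) by ring.
      apply Rmult_le_compat_r; [apply Rabs_pos|]. lra.
Qed.

Lemma Ssum_lipschitz (rho : nat -> R) (M x y d B : R) :
  harmonic_bound rho M -> away rho x d -> away rho y d -> Rabs x <= B -> Rabs y <= B ->
  Rabs (Ssum rho x - Ssum rho y) <= M * (1 + (B + 1) / d) ^ 2 * (PI ^ 2 / 6) * Rabs (x - y).
Proof.
  intros Hr Hx Hy HBx HBy. unfold Ssum.
  rewrite <- Series_minus by (eapply ex_Ssum; eassumption).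
  replace (M * (1 + (B + 1) / d) ^ 2 * (PI ^ 2 / 6) * Rabs (x - y))
    with (M * (1 + (B + 1) / d) ^ 2 * Rabs (x - y) * (PI ^ 2 / 6)) by ring.
  apply Series_invsq_bound. intros j. apply Ssum_diff_term; assumption.
Qed.

Lemma away_near (rho : nat -> R) (x y d : R) :
  away rho y d -> Rabs (x - y) <= d / 2 -> away rho x (d / 2).
Proof.
  intros [Hd Hy] Hxy. split; [lra|]. intros j. destruct (Hy j) as [H|H]; [left; exact H|right].
  pose proof (Rabs_triang_inv (y + INR j) (y - x)) as T.
  replace (y + INR j - (y - x)) with (x + INR j) in T by ring.
  rewrite (Rabs_minus_sym y x) in T. lra.
Qed.

Lemma continuity_pt_lipschitz (f : R -> R) (y K d : R) :
  0 < d -> (forall x, Rabs (x - y) < d -> Rabs (f x - f y) <= K * Rabs (x - y)) -> continuity_pt f y.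
Proof.
  intros Hd H e He.
  assert (HK : 0 < Rabs K + 1) by (pose proof (Rabs_pos K); lra).
  exists (Rmin d (e / (Rabs K + 1))). split.
  - apply Rmin_glb_lt; [exact Hd|]. apply Rdiv_lt_0_compat; lra.
  - intros x [_ Hx]. simpl in *. unfold Rdist in *.
    assert (H1 : Rabs (x - y) < d) by (eapply Rlt_le_trans; [exact Hx|apply Rmin_l]).
    assert (H2 : Rabs (x - y) < e / (Rabs K + 1)) by (eapply Rlt_le_trans; [exact Hx|apply Rmin_r]).
    specialize (H x H1). pose proof (Rle_abs K). pose proof (Rabs_pos (x - y)).
    apply (Rmult_lt_compat_r (Rabs K + 1)) in H2; [|exact HK].
    unfold Rdiv in H2. rewrite Rmult_assoc, Rinv_l, Rmult_1_r in H2 by lra. nra.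
Qed.

Lemma Ssum_continuous (rho : nat -> R) (M y d : R) :
  harmonic_bound rho M -> away rho y d -> continuity_pt (Ssum rho) y.
Proof.
  intros Hr Hy. pose proof Hy as [Hd Hy'].
  apply continuity_pt_lipschitz
    with (K := M * (1 + (Rabs y + d / 2 + 1) / (d / 2)) ^ 2 * (PI ^ 2 / 6)) (d := d / 2); [lra|].
  intros x Hx. apply Ssum_lipschitz; [assumption| | | |].
  - apply away_near with y; [exact Hy|lra].
  - apply away_near with y; [exact Hy|]. replace (y - y) with 0 by ring. rewrite Rabs_R0. lra.
  - pose proof (Rabs_triang_inv x y). lra.
  - lra.
Qed.

Lemma is_series_at (k : nat) (v : R) : is_series (fun j => if Nat.eqb j k then v else 0) v.
Proof.
  apply is_series_Psum. apply is_lim_seq_ext_loc with (fun _ => v); [|apply is_lim_seq_const].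
  exists (S k). intros n Hn.
  replace n with (S k + (n - S k))%nat by lia.
  rewrite Psum_app. cbn [Psum]. rewrite Nat.eqb_refl.
  rewrite (Psum_ext _ (fun _ => 0) k).
  2:{ intros j Hj. destruct (Nat.eqb_spec j k); [lia|reflexivity]. }
  rewrite (Psum_ext _ (fun _ => 0) (n - S k)).
  2:{ intros j Hj. destruct (Nat.eqb_spec (S k + j) k); [lia|reflexivity]. }
  rewrite !Psum_const. ring.
Qed.

(** Zeroing a residue, with the indices kept, leaves [away] satisfiable at the pole [-k] itself, so
    the remaining sum can be evaluated and is continuous there. *)
Definition drop (k : nat) (rho : nat -> R) (j : nat) : R := if Nat.eqb j k then 0 else rho j.

Lemma drop_bound (k : nat) (rho : nat -> R) (M : R) :
  harmonic_bound rho M -> harmonic_bound (drop k rho) M.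
Proof.
  intros [HM H]. split; [exact HM|]. intros j. unfold drop. destruct (Nat.eqb j k); [|apply H].
  rewrite Rabs_R0. pose proof (pos_INR j). apply Rdiv_le_0_compat; lra.
Qed.

Lemma drop_away (k : nat) (rho : nat -> R) (z d : R) : away rho z d -> away (drop k rho) z d.
Proof.
  intros [Hd H]. split; [exact Hd|]. intros j. unfold drop.
  destruct (Nat.eqb j k); [left; reflexivity|apply H].
Qed.

Lemma Ssum_drop (k : nat) (rho : nat -> R) (M z d : R) :
  harmonic_bound rho M -> away rho z d ->
  Ssum rho z = rho k / (z + INR k) + Ssum (drop k rho) z.
Proof.
  intros Hr Hz. unfold Ssum.
  rewrite <- (is_series_unique _ _ (is_series_at k (rho k / (z + INR k)))).
  rewrite <- Series_plus.
  - apply Series_ext. intros j. unfold drop. destruct (Nat.eqb_spec j k) as [->|]; unfold Rdiv; ring.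
  - eexists. apply is_series_at.
  - eapply ex_Ssum; [apply drop_bound, Hr|apply drop_away, Hz].
Qed.

(** Termwise, [1/(z + j) = 1/j - z/j^2 + z^2/(j^2 (z + j))]. For [j >= 1] and [|z| <= 1/2] the last
    denominator satisfies [z + j >= 1/2], so the remainders are summable uniformly in [z]. *)
Lemma Ssum_expansion (rho : nat -> R) (M : R) :
  harmonic_bound rho M -> rho O = 0 ->
  exists K, forall z, Rabs z <= / 2 ->
    Rabs (Ssum rho z - (Ssum rho 0 - Series (fun j => rho j / INR j ^ 2) * z)) <= K * z ^ 2.
Proof.
  intros Hr H0. pose proof Hr as [HM Hb].
  exists (M * 8 * (PI ^ 2 / 6)). intros z Hz.
  assert (Ha : forall x, Rabs x <= / 2 -> away rho x (/ 2)).
  { intros x Hx. split; [lra|]. intros [|j]; [left; exact H0|right].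
    rewrite S_INR. pose proof (pos_INR j). apply Rabs_le_between in Hx.
    rewrite Rabs_pos_eq; lra. }
  assert (HS : forall j, Rabs (rho j / INR j ^ 2) <= M * 2 * invsq j).
  { intros [|j].
    - rewrite H0. unfold Rdiv. rewrite Rmult_0_l, Rabs_R0. pose proof (invsq_pos 0). nra.
    - unfold Rdiv. rewrite Rabs_mult, Rabs_inv. specialize (Hb (S j)).
      unfold invsq. rewrite !S_INR in *. pose proof (pos_INR j).
      rewrite (Rabs_pos_eq ((INR j + 1) ^ 2)) by nra.
      apply Rle_trans with (M / (INR j + 1 + 1) * / (INR j + 1) ^ 2).
      + apply Rmult_le_compat_r; [|exact Hb]. apply Rlt_le, Rinv_0_lt_compat. nra.
      + replace (M * 2 * / (INR j + 1 + 1) ^ 2) with (M / (INR j + 1 + 1) * (2 / (INR j + 1 + 1))) by (field; lra).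
        apply Rmult_le_compat_l; [apply Rdiv_le_0_compat; lra|].
        apply Rmult_le_reg_l with ((INR j + 1) ^ 2 * (INR j + 1 + 1)); [nra|].
        replace ((INR j + 1) ^ 2 * (INR j + 1 + 1) * / (INR j + 1) ^ 2) with (INR j + 1 + 1) by (field; lra).
        replace ((INR j + 1) ^ 2 * (INR j + 1 + 1) * (2 / (INR j + 1 + 1))) with (2 * (INR j + 1) ^ 2) by (field; lra).
        nra. }
  unfold Ssum.
  rewrite <- Series_scal_r.
  rewrite <- Series_minus.
  2:{ apply (ex_Ssum rho M 0 (/2)); [exact Hr|apply Ha; rewrite Rabs_R0; lra]. }
  2:{ apply ex_series_scal_r.
      apply ex_series_invsq_bound with (1 := HS). }
  rewrite <- Series_minus.
  2:{ apply (ex_Ssum rho M z (/2)); [exact Hr|apply Ha, Hz]. }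
  2:{ apply (@ex_series_minus R_AbsRing R_NormedModule).
      - apply (ex_Ssum rho M 0 (/2)); [exact Hr|apply Ha; rewrite Rabs_R0; lra].
      - apply ex_series_scal_r. apply ex_series_invsq_bound with (1 := HS). }
  replace (M * 8 * (PI ^ 2 / 6) * z ^ 2) with (M * 8 * z ^ 2 * (PI ^ 2 / 6)) by ring.
  apply Series_invsq_bound. intros [|j].
  { rewrite H0. unfold Rdiv. rewrite !Rmult_0_l, !Rminus_0_r, Rabs_R0.
    pose proof (invsq_pos 0). pose proof (pow2_ge_0 z).
    apply Rmult_le_pos; [apply Rmult_le_pos|]; lra. }
  specialize (HS (S j)).
  apply Rabs_le_between in Hz.
  rewrite S_INR in *. pose proof (pos_INR j).
  replace (rho (S j) / (z + (INR j + 1)) - (rho (S j) / (0 + (INR j + 1)) - rho (S j) / (INR j + 1) ^ 2 * z))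
    with (rho (S j) / (INR j + 1) ^ 2 * (z ^ 2 * / (z + (INR j + 1)))) by (field; lra).
  rewrite Rabs_mult.
  apply Rle_trans with (M * 2 * invsq (S j) * (z ^ 2 * 2)).
  - apply Rmult_le_compat; [apply Rabs_pos|apply Rabs_pos|exact HS|].
    rewrite Rabs_pos_eq.
    + apply Rmult_le_compat_l; [apply pow2_ge_0|].
      replace 2 with (/ / 2) by field. apply Rinv_le_contravar; lra.
    + apply Rmult_le_pos; [apply pow2_ge_0|]. apply Rlt_le, Rinv_0_lt_compat. lra.
  - pose proof (invsq_pos (S j)). pose proof (pow2_ge_0 z).
    assert (0 <= M * z ^ 2 * invsq (S j)) by (apply Rmult_le_pos; [apply Rmult_le_pos|]; lra). lra.
Qed.

(** * Second-order jets at 0 *)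

(* [z = 0] is left out because [f] will often have a removable singularity there. *)
Definition Jet (f : R -> R) (a b c : R) : Prop :=
  exists M d, 0 < d <= 1 /\ 0 <= M /\
    forall z, z <> 0 -> Rabs z < d -> Rabs (f z - (a + b * z + c * z ^ 2)) <= M * Rabs z ^ 3.

Lemma jet_ext (f g : R -> R) (a b c d : R) :
  0 < d -> (forall z, z <> 0 -> Rabs z < d -> f z = g z) -> Jet f a b c -> Jet g a b c.
Proof.
  intros Hd H (M & e & He & HM & Hf). exists M, (Rmin d e). repeat split.
  - apply Rmin_glb_lt; lra.
  - pose proof (Rmin_r d e). lra.
  - exact HM.
  - intros z Hz Hlt. pose proof (Rmin_l d e). pose proof (Rmin_r d e).
    rewrite <- H by (auto; lra). apply Hf; [auto|lra].
Qed.

Lemma jet_quadratic (a b c : R) : Jet (fun z => a + b * z + c * z ^ 2) a b c.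
Proof.
  exists 0, 1. repeat split; try lra. intros z _ _.
  replace (a + b * z + c * z ^ 2 - (a + b * z + c * z ^ 2)) with 0 by ring. rewrite Rabs_R0. lra.
Qed.

Lemma jet_mult (f g : R -> R) (a b c a' b' c' : R) :
  Jet f a b c -> Jet g a' b' c' ->
  Jet (fun z => f z * g z) (a * a') (a * b' + b * a') (a * c' + b * b' + c * a').
Proof.
  intros (M & d & Hd & HM & Hf) (M' & d' & Hd' & HM' & Hg).
  set (K := Rabs a + Rabs b + Rabs c). set (K' := Rabs a' + Rabs b' + Rabs c').
  assert (HK : 0 <= K) by (unfold K; pose proof (Rabs_pos a); pose proof (Rabs_pos b); pose proof (Rabs_pos c); lra).
  assert (HK' : 0 <= K') by (unfold K'; pose proof (Rabs_pos a'); pose proof (Rabs_pos b'); pose proof (Rabs_pos c'); lra).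
  exists (K * K' + K * M' + M * K' + M * M'), (Rmin d d'). repeat split.
  - apply Rmin_glb_lt; lra.
  - pose proof (Rmin_r d d'). lra.
  - assert (0 <= K * K') by (apply Rmult_le_pos; lra).
    assert (0 <= K * M') by (apply Rmult_le_pos; lra).
    assert (0 <= M * K') by (apply Rmult_le_pos; lra).
    assert (0 <= M * M') by (apply Rmult_le_pos; lra). lra.
  - intros z Hz Hlt. pose proof (Rmin_l d d'). pose proof (Rmin_r d d').
    specialize (Hf z Hz ltac:(lra)). specialize (Hg z Hz ltac:(lra)).
    set (P := a + b * z + c * z ^ 2) in *. set (P' := a' + b' * z + c' * z ^ 2) in *.
    set (t := Rabs z) in *.
    assert (Ht : 0 <= t < 1) by (unfold t; pose proof (Rabs_pos z); split; [lra|fold t; lra]).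
    assert (Bd : forall u v w, Rabs (u + v * z + w * z ^ 2) <= Rabs u + Rabs v + Rabs w).
    { intros u v w.
      eapply Rle_trans; [apply Rabs_triang|]. apply Rplus_le_compat.
      - eapply Rle_trans; [apply Rabs_triang|]. rewrite Rabs_mult. fold t.
        pose proof (Rabs_pos v). nra.
      - rewrite Rabs_mult, <- RPow_abs. fold t. pose proof (Rabs_pos w).
        assert (t ^ 2 <= 1) by nra. nra. }
    pose proof (Bd a b c) as HP. fold P K in HP.
    pose proof (Bd a' b' c') as HP'. fold P' K' in HP'.
    assert (HQ : Rabs ((b * c' + c * b') + (c * c') * z) <= K * K').
    { eapply Rle_trans; [apply Rabs_triang|].
      eapply Rle_trans; [apply Rplus_le_compat; [apply Rabs_triang|apply Rle_refl]|].
      rewrite !Rabs_mult. fold t. unfold K, K'.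
      pose proof (Rabs_pos a); pose proof (Rabs_pos b); pose proof (Rabs_pos c).
      pose proof (Rabs_pos a'); pose proof (Rabs_pos b'); pose proof (Rabs_pos c').
      assert (0 <= Rabs c * Rabs c') by (apply Rmult_le_pos; lra).
      assert (0 <= Rabs a * (Rabs a' + Rabs b' + Rabs c')) by (apply Rmult_le_pos; lra).
      assert (0 <= Rabs b * (Rabs a' + Rabs b')) by (apply Rmult_le_pos; lra).
      assert (0 <= Rabs c * (Rabs a')) by (apply Rmult_le_pos; lra).
      nra. }
    (* The error splits exactly into the terms of [P P'] of degree 3 and 4, the two products of a
       polynomial with an error, and the product of the errors; each is bounded by a multiple of
       [t^3]. *)
    replace (f z * g z - (a * a' + (a * b' + b * a') * z + (a * c' + b * b' + c * a') * z ^ 2))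
      with (((b * c' + c * b') + (c * c') * z) * z ^ 3 + P * (g z - P') + (f z - P) * P' + (f z - P) * (g z - P'))
      by (unfold P, P'; ring).
    assert (Ht3 : 0 <= t ^ 3 <= 1).
    { split; [apply pow_le; lra|]. rewrite <- (pow1 3). apply pow_incr. lra. }
    assert (E1 : Rabs (((b * c' + c * b') + (c * c') * z) * z ^ 3) <= K * K' * t ^ 3).
    { rewrite Rabs_mult, <- RPow_abs. fold t. apply Rmult_le_compat_r; lra. }
    assert (E2 : Rabs (P * (g z - P')) <= K * M' * t ^ 3).
    { rewrite Rabs_mult, Rmult_assoc. apply Rmult_le_compat; auto using Rabs_pos. }
    assert (E3 : Rabs ((f z - P) * P') <= M * K' * t ^ 3).
    { rewrite Rabs_mult. replace (M * K' * t ^ 3) with (M * t ^ 3 * K') by ring.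
      apply Rmult_le_compat; auto using Rabs_pos. }
    assert (E4 : Rabs ((f z - P) * (g z - P')) <= M * M' * t ^ 3).
    { rewrite Rabs_mult. apply Rle_trans with (M * t ^ 3 * (M' * t ^ 3)).
      - apply Rmult_le_compat; auto using Rabs_pos.
      - replace (M * M' * t ^ 3) with (M * t ^ 3 * (M' * 1)) by ring.
        apply Rmult_le_compat_l; [apply Rmult_le_pos; lra|]. apply Rmult_le_compat_l; lra. }
    eapply Rle_trans; [apply Rabs_triang|].
    eapply Rle_trans; [apply Rplus_le_compat_r, Rabs_triang|].
    eapply Rle_trans; [apply Rplus_le_compat_r, Rplus_le_compat_r, Rabs_triang|]. lra.
Qed.

Lemma eq0_of_linear_bound (A K d : R) :
  0 < d -> (forall z, 0 < z < d -> Rabs A <= K * z) -> A = 0.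
Proof.
  intros Hd H. destruct (Req_dec A 0) as [E|E]; [exact E|exfalso].
  pose proof (Rabs_pos_lt A E) as HA.
  assert (HK : 0 < Rabs K + 1) by (pose proof (Rabs_pos K); lra).
  set (z := Rmin (d / 2) (Rabs A / (2 * (Rabs K + 1)))).
  assert (Hz : 0 < z) by (apply Rmin_glb_lt; [lra|apply Rdiv_lt_0_compat; lra]).
  assert (Hz1 : z <= d / 2) by apply Rmin_l.
  assert (Hz2 : z <= Rabs A / (2 * (Rabs K + 1))) by apply Rmin_r.
  specialize (H z ltac:(lra)). pose proof (Rle_abs K).
  apply (Rmult_le_compat_r (2 * (Rabs K + 1))) in Hz2; [|lra].
  unfold Rdiv in Hz2. rewrite Rmult_assoc, Rinv_l, Rmult_1_r in Hz2 by lra. nra.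
Qed.

Lemma jet_unique (f : R -> R) (a b c a' b' c' : R) :
  Jet f a b c -> Jet f a' b' c' -> a = a' /\ b = b' /\ c = c'.
Proof.
  intros (M & d & Hd & HM & Hf) (M' & d' & Hd' & HM' & Hg).
  set (e := Rmin d d').
  assert (He : 0 < e <= 1) by (split; [apply Rmin_glb_lt; lra|unfold e; pose proof (Rmin_l d d'); lra]).
  assert (H : forall z, 0 < z < e ->
     Rabs ((a - a') + (b - b') * z + (c - c') * z ^ 2) <= (M + M') * z ^ 3).
  { intros z Hz. assert (e <= d) by apply Rmin_l. assert (e <= d') by apply Rmin_r.
    assert (Az : Rabs z = z) by (apply Rabs_pos_eq; lra).
    specialize (Hf z ltac:(lra) ltac:(lra)). specialize (Hg z ltac:(lra) ltac:(lra)).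
    rewrite Az in Hf, Hg.
    replace ((a - a') + (b - b') * z + (c - c') * z ^ 2)
      with ((f z - (a' + b' * z + c' * z ^ 2)) - (f z - (a + b * z + c * z ^ 2))) by ring.
    eapply Rle_trans; [apply Rabs_triang|]. rewrite Rabs_Ropp. lra. }
  assert (Ea : a - a' = 0).
  { apply eq0_of_linear_bound with (K := Rabs (b - b') + Rabs (c - c') + (M + M')) (d := e); [lra|].
    intros z Hz. specialize (H z Hz).
    pose proof (Rabs_triang_inv (a - a' + (b - b') * z + (c - c') * z ^ 2) ((b - b') * z + (c - c') * z ^ 2)) as T.
    pose proof (Rabs_triang (a - a' + (b - b') * z + (c - c') * z ^ 2) (- ((b - b') * z + (c - c') * z ^ 2))) as T'.
    replace (a - a' + (b - b') * z + (c - c') * z ^ 2 + - ((b - b') * z + (c - c') * z ^ 2)) with (a - a') in T' by ring.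
    rewrite Rabs_Ropp in T'.
    pose proof (Rabs_triang ((b - b') * z) ((c - c') * z ^ 2)) as T2.
    rewrite !Rabs_mult, (Rabs_pos_eq z), (Rabs_pos_eq (z ^ 2)) in T2 by nra.
    pose proof (Rabs_pos (b - b')). pose proof (Rabs_pos (c - c')).
    assert (z ^ 2 <= z) by nra. assert (z ^ 3 <= z) by nra. nra. }
  assert (Eb : b - b' = 0).
  { apply eq0_of_linear_bound with (K := Rabs (c - c') + (M + M')) (d := e); [lra|].
    intros z Hz. specialize (H z Hz). rewrite Ea in H.
    replace (0 + (b - b') * z + (c - c') * z ^ 2) with (z * ((b - b') + (c - c') * z)) in H by ring.
    rewrite Rabs_mult, (Rabs_pos_eq z) in H by lra.
    assert (H2 : Rabs ((b - b') + (c - c') * z) <= (M + M') * z ^ 2).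
    { apply Rmult_le_reg_l with z; [lra|]. replace (z * ((M + M') * z ^ 2)) with ((M + M') * z ^ 3) by ring. exact H. }
    pose proof (Rabs_triang ((b - b') + (c - c') * z) (- ((c - c') * z))) as T.
    replace (b - b' + (c - c') * z + - ((c - c') * z)) with (b - b') in T by ring.
    rewrite Rabs_Ropp, (Rabs_mult (c - c')), (Rabs_pos_eq z) in T by lra.
    assert (z ^ 2 <= z) by nra. nra. }
  assert (Ec : c - c' = 0).
  { apply eq0_of_linear_bound with (K := M + M') (d := e); [lra|].
    intros z Hz. specialize (H z Hz). rewrite Ea, Eb in H.
    replace (0 + 0 * z + (c - c') * z ^ 2) with (z ^ 2 * (c - c')) in H by ring.
    rewrite Rabs_mult, (Rabs_pos_eq (z ^ 2)) in H by nra.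
    apply Rmult_le_reg_l with (z ^ 2); [nra|].
    replace (z ^ 2 * ((M + M') * z)) with ((M + M') * z ^ 3) by ring. exact H. }
  repeat split; lra.
Qed.

(* The jet of a product of factors [1 + x z], with [e] the sum of the [x] and [s] the sum of
   the [x^2] (Newton): both are additive under multiplication. *)
Definition NJet (f : R -> R) (e s : R) : Prop := Jet f 1 e ((e ^ 2 - s) / 2).

Lemma njet_mult (f g : R -> R) (e s e' s' : R) :
  NJet f e s -> NJet g e' s' -> NJet (fun z => f z * g z) (e + e') (s + s').
Proof.
  intros Hf Hg. pose proof (jet_mult _ _ _ _ _ _ _ _ Hf Hg) as H. unfold NJet.
  replace 1 with (1 * 1) by ring.
  replace (e + e') with (1 * e' + e * 1) by ring.
  replace (((1 * e' + e * 1) ^ 2 - (s + s')) / 2)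
    with (1 * ((e' ^ 2 - s') / 2) + e * e' + (e ^ 2 - s) / 2 * 1) by field.
  exact H.
Qed.

Lemma njet_unique (f : R -> R) (e s e' s' : R) : NJet f e s -> NJet f e' s' -> e = e' /\ s = s'.
Proof.
  intros Hf Hg. destruct (jet_unique _ _ _ _ _ _ _ Hf Hg) as (_ & E1 & E2).
  split; [exact E1|]. rewrite E1 in E2. lra.
Qed.

Lemma njet_prod (x : nat -> R) (n : nat) :
  NJet (fun z => Pprod (fun j => 1 + x j * z) n) (Psum x n) (Psum (fun j => x j ^ 2) n).
Proof.
  induction n as [|n IH].
  - apply jet_ext with (f := fun z => 1 + 0 * z + (0 ^ 2 - 0) / 2 * z ^ 2) (d := 1); [lra| |apply jet_quadratic].
    intros z _ _. simpl. field.
  - cbn [Pprod Psum]. apply (njet_mult (fun z => Pprod (fun j => 1 + x j * z) n) (fun z => 1 + x n * z)); [exact IH|].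
    apply jet_ext with (f := fun z => 1 + x n * z + (x n ^ 2 - x n ^ 2) / 2 * z ^ 2) (d := 1); [lra| |apply jet_quadratic].
    intros z _ _. field.
Qed.

(** * Polynomial functions with few coefficients *)

(** Polynomials of degree below [n] in Horner form, as a property of the function, so that
    coefficients never have to be named. *)
Fixpoint poly_size (n : nat) (f : R -> R) : Prop :=
  match n with
  | O => forall x, f x = 0
  | S m => exists c g, poly_size m g /\ forall x, f x = c + x * g x
  end.

Lemma poly_size_ext (n : nat) (f g : R -> R) :
  (forall x, f x = g x) -> poly_size n f -> poly_size n g.
Proof.
  destruct n; simpl; intros H Hf.
  - intros x. rewrite <- H. apply Hf.
  - destruct Hf as (c & h & Hh & E). exists c, h. split; [exact Hh|]. intros x. rewrite <- H. apply E.
Qed.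

Lemma poly_size_plus (n : nat) (f g : R -> R) :
  poly_size n f -> poly_size n g -> poly_size n (fun x => f x + g x).
Proof.
  revert f g. induction n as [|n IH]; simpl; intros f g Hf Hg.
  - intros x. rewrite Hf, Hg. ring.
  - destruct Hf as (c & h & Hh & E), Hg as (c' & h' & Hh' & E').
    exists (c + c'), (fun x => h x + h' x). split; [apply IH; assumption|].
    intros x. rewrite E, E'. ring.
Qed.

Lemma poly_size_scal (n : nat) (k : R) (f : R -> R) :
  poly_size n f -> poly_size n (fun x => k * f x).
Proof.
  revert f. induction n as [|n IH]; simpl; intros f Hf.
  - intros x. rewrite Hf. ring.
  - destruct Hf as (c & h & Hh & E).
    exists (k * c), (fun x => k * h x). split; [apply IH; assumption|].
    intros x. rewrite E. ring.
Qed.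

Lemma poly_size_S (n : nat) (f : R -> R) : poly_size n f -> poly_size (S n) f.
Proof.
  revert f. induction n as [|n IH]; intros f Hf.
  - exists 0, (fun _ => 0). split; [intros x; reflexivity|]. intros x. simpl in Hf. rewrite Hf. ring.
  - destruct Hf as (c & h & Hh & E). exists c, h. split; [apply IH, Hh|exact E].
Qed.

Lemma poly_size_mult_linear (n : nat) (d : R) (f : R -> R) :
  poly_size n f -> poly_size (S n) (fun x => f x * (x + d)).
Proof.
  intros Hf. apply poly_size_ext with (fun x => d * f x + (0 + x * f x)); [intros; ring|].
  apply poly_size_plus.
  - apply poly_size_S, poly_size_scal, Hf.
  - exists 0, f. split; [exact Hf|reflexivity].
Qed.

(** With [f x = c + x h x] and, by induction, [h x - h r = (x - r) g x], one has [f x - f r = x h x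
    - r h r = (x - r) (h r + x g x)]. *)
Lemma poly_size_factor (n : nat) (f : R -> R) (r : R) :
  poly_size (S n) f -> f r = 0 -> exists g, poly_size n g /\ forall x, f x = (x - r) * g x.
Proof.
  revert f. induction n as [|n IH]; intros f (c & h & Hh & E) Hr.
  - simpl in Hh. exists (fun _ => 0). split; [intros x; reflexivity|].
    intros x. rewrite E in Hr |- *. rewrite !Hh in *. lra.
  - destruct (IH (fun x => h x - h r)) as (g & Hg & Eg).
    + apply poly_size_ext with (fun x => h x + (- h r + x * 0)); [intros; ring|].
      apply poly_size_plus; [exact Hh|]. exists (- h r), (fun _ => 0). split; [|reflexivity].
      clear. induction n as [|n IHn]; [intros x; reflexivity|].
      exists 0, (fun _ => 0). split; [exact IHn|intros; ring].
    + ring.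
    + exists (fun x => h r + x * g x). split.
      * exists (h r), g. split; [exact Hg|reflexivity].
      * intros x. rewrite E in Hr |- *. specialize (Eg x).
        replace (h x) with (h r + (x - r) * g x) by lra.
        replace c with (- (r * h r)) by lra. ring.
Qed.

Lemma poly_size_roots (n : nat) (f : R -> R) (zeta : nat -> R) :
  poly_size (S n) f ->
  (forall i, (i < n)%nat -> f (zeta i) = 0) ->
  (forall i j, (i < j < n)%nat -> zeta i <> zeta j) ->
  exists c, forall x, f x = c * Pprod (fun i => x - zeta i) n.
Proof.
  revert f. induction n as [|n IH]; intros f Hf H0 Hd.
  - destruct Hf as (c & h & Hh & E). exists c. intros x. rewrite E. simpl in Hh. rewrite Hh. simpl. ring.
  - destruct (poly_size_factor _ _ (zeta n) Hf (H0 n ltac:(lia))) as (g & Hg & Eg).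
    destruct (IH g Hg) as (c & Hc).
    + intros i Hi. assert (E : f (zeta i) = 0) by (apply H0; lia). rewrite Eg in E.
      apply Rmult_integral in E. destruct E as [E|E]; [|exact E].
      exfalso. apply (Hd i n); [lia|lra].
    + intros i j Hij. apply Hd. lia.
    + exists c. intros x. rewrite Eg, Hc. cbn [Pprod]. ring.
Qed.

(** * Zeros of a positive sum of simple fractions between its poles *)

Lemma Series_le_ex (u v : nat -> R) :
  (forall j, u j <= v j) -> ex_series u -> ex_series v -> Series u <= Series v.
Proof.
  intros H Hu Hv.
  assert (E : 0 <= Series (fun j => v j - u j)).
  { rewrite <- (Rmult_0_l (Series (fun j => v j - u j))), <- Series_scal_l.
    apply Series_le.
    - intros j. specialize (H j). lra.
    - apply (@ex_series_minus R_AbsRing R_NormedModule); assumption. }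
  rewrite Series_minus in E by assumption. lra.
Qed.

Definition gap (k : nat) (z : R) : Prop := - (INR k + 1) < z < - INR k.

Lemma gap_cases (k : nat) (z : R) (j : nat) :
  gap k z -> ((j <= k)%nat /\ z + INR j <= z + INR k < 0) \/ ((k < j)%nat /\ 0 < z + INR k + 1 <= z + INR j).
Proof.
  intros [H1 H2]. destruct (Nat.le_gt_cases j k) as [H|H].
  - left. split; [exact H|]. apply le_INR in H. lra.
  - right. split; [exact H|]. assert (Hj : (S k <= j)%nat) by lia.
    apply le_INR in Hj. rewrite S_INR in Hj. lra.
Qed.

Lemma gap_away (rho : nat -> R) (k : nat) (z : R) :
  gap k z -> away rho z (Rmin (z + INR k + 1) (- INR k - z)).
Proof.
  intros Hz. pose proof Hz as [H1 H2]. split; [apply Rmin_glb_lt; lra|].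
  intros j. right. pose proof (Rmin_l (z + INR k + 1) (- INR k - z)).
  pose proof (Rmin_r (z + INR k + 1) (- INR k - z)).
  destruct (gap_cases k z j Hz) as [[_ H3]|[_ H3]].
  - rewrite Rabs_left1; lra.
  - rewrite Rabs_pos_eq; lra.
Qed.

Lemma drop_drop_away (rho : nat -> R) (k : nat) (z : R) :
  - (INR k + 1) <= z <= - INR k -> away (drop k (drop (S k) rho)) z 1.
Proof.
  intros Hz. split; [lra|]. intros j. unfold drop.
  destruct (Nat.eqb_spec j k); [left; reflexivity|].
  destruct (Nat.eqb_spec j (S k)); [left; reflexivity|right].
  destruct (Nat.le_gt_cases j k) as [H|H].
  - assert (Hj : (S j <= k)%nat) by lia. apply le_INR in Hj. rewrite S_INR in Hj.
    rewrite Rabs_left1; lra.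
  - assert (Hj : (S (S k) <= j)%nat) by lia. apply le_INR in Hj. rewrite !S_INR in Hj.
    rewrite Rabs_pos_eq; lra.
Qed.

(* Multiplied by [(z + k) (z + k + 1)], the sum is continuous on the closed gap and takes the
   values [rho k > 0] and [- rho (S k) < 0] at its ends. *)
Lemma gap_root_exists (rho : nat -> R) (M : R) (k : nat) :
  harmonic_bound rho M -> 0 < rho k -> 0 < rho (S k) -> exists z, gap k z /\ Ssum rho z = 0.
Proof.
  intros Hr Hk HSk.
  set (rest := drop k (drop (S k) rho)).
  assert (Hrest : harmonic_bound rest M) by (apply drop_bound, drop_bound, Hr).
  set (H := fun z => rho k * (z + INR k + 1) + rho (S k) * (z + INR k)
                     + (z + INR k) * (z + INR k + 1) * Ssum rest z).
  destruct (Ranalysis5.IVT_interv H (- (INR k + 1)) (- INR k)) as [z [Hz Ez]].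
  - intros a Ha. unfold H.
    assert (Ca : continuity_pt (Ssum rest) a)
      by (apply Ssum_continuous with M 1; [exact Hrest|apply drop_drop_away, Ha]).
    apply continuity_pt_plus.
    + apply derivable_continuous_pt. apply ex_derive_Reals_0. auto_derive. trivial.
    + apply continuity_pt_mult; [|exact Ca].
      apply derivable_continuous_pt. apply ex_derive_Reals_0. auto_derive. trivial.
  - lra.
  - unfold H. replace (- (INR k + 1) + INR k) with (-1) by ring.
    replace (rho k * (-1 + 1) + rho (S k) * -1 + -1 * (-1 + 1) * Ssum rest (- (INR k + 1))) with (- rho (S k)) by ring. lra.
  - unfold H. replace (- INR k + INR k) with 0 by ring.
    replace (rho k * (0 + 1) + rho (S k) * 0 + 0 * (0 + 1) * Ssum rest (- INR k)) with (rho k) by ring. lra.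
  - assert (N1 : z <> - (INR k + 1)).
    { intros E. revert Ez. unfold H. rewrite E.
      replace (- (INR k + 1) + INR k) with (-1) by ring. intros Ez. lra. }
    assert (N2 : z <> - INR k).
    { intros E. revert Ez. unfold H. rewrite E.
      replace (- INR k + INR k) with 0 by ring. intros Ez. lra. }
    assert (Hg : gap k z) by (unfold gap; lra).
    exists z. split; [exact Hg|].
    pose proof (gap_away rho k z Hg) as Ha. pose proof (gap_away (drop (S k) rho) k z Hg) as Ha'.
    rewrite (Ssum_drop (S k) rho M z _ Hr Ha).
    rewrite (Ssum_drop k (drop (S k) rho) M z _ (drop_bound _ _ _ Hr) Ha').
    fold rest. unfold drop at 1. destruct (Nat.eqb_spec k (S k)); [lia|].
    apply Rmult_eq_reg_l with ((z + INR k) * (z + INR k + 1)).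
    + rewrite Rmult_0_r. rewrite <- Ez. unfold H. rewrite S_INR. field. split; lra.
    + apply Rmult_integral_contrapositive. split; lra.
Qed.

(** Inside a gap no [z + j] changes sign, so each [1/(z + j)] decreases. Series comparison yields
    only a weak inequality; the term [k] is split off to make it strict. *)
Lemma Ssum_gap_decreasing (rho : nat -> R) (M : R) (k : nat) (x y : R) :
  harmonic_bound rho M -> (forall j, 0 <= rho j) -> 0 < rho k ->
  gap k x -> gap k y -> x < y -> Ssum rho y < Ssum rho x.
Proof.
  intros Hr Hp Hk Hx Hy Hxy.
  pose proof (gap_away rho k x Hx) as Ax. pose proof (gap_away rho k y Hy) as Ay.
  rewrite (Ssum_drop k rho M x _ Hr Ax), (Ssum_drop k rho M y _ Hr Ay).
  assert (Inv : forall j, / (y + INR j) < / (x + INR j)).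
  { intros j.
    destruct (gap_cases k x j Hx) as [[Hj Hjx]|[Hj Hjx]], (gap_cases k y j Hy) as [[Hj' Hjy]|[Hj' Hjy]]; try lia.
    - assert (P : 0 < / - (y + INR j) - / - (x + INR j)).
      { apply Rlt_0_minus, Rinv_lt_contravar; [nra|lra]. }
      rewrite !Rinv_opp in P. lra.
    - apply Rinv_lt_contravar; [nra|lra]. }
  apply Rplus_lt_le_compat.
  - apply Rmult_lt_compat_l; [exact Hk|apply Inv].
  - apply Series_le_ex.
    + intros j. apply Rmult_le_compat_l; [|apply Rlt_le, Inv].
      unfold drop. destruct (Nat.eqb j k); [lra|apply Hp].
    + eapply ex_Ssum; [apply drop_bound, Hr|apply drop_away, Ay].
    + eapply ex_Ssum; [apply drop_bound, Hr|apply drop_away, Ax].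
Qed.

Lemma gap_root_unique (rho : nat -> R) (M : R) (k : nat) (x y : R) :
  harmonic_bound rho M -> (forall j, 0 <= rho j) -> 0 < rho k ->
  gap k x -> gap k y -> Ssum rho x = 0 -> Ssum rho y = 0 -> x = y.
Proof.
  intros Hr Hp Hk Hx Hy Ex Ey. destruct (Rtotal_order x y) as [H|[H|H]]; [|exact H|].
  - pose proof (Ssum_gap_decreasing rho M k x y Hr Hp Hk Hx Hy H). lra.
  - pose proof (Ssum_gap_decreasing rho M k y x Hr Hp Hk Hy Hx H). lra.
Qed.

(** * Truncated sums and the power sum of their zeros *)

Definition trunc (N : nat) (rho : nat -> R) (j : nat) : R := if Nat.ltb j N then rho j else 0.

Lemma trunc_lt (N : nat) (rho : nat -> R) (j : nat) : (j < N)%nat -> trunc N rho j = rho j.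
Proof. intros H. unfold trunc. destruct (Nat.ltb_spec j N); [reflexivity|lia]. Qed.

Lemma trunc_ge (N : nat) (rho : nat -> R) (j : nat) : (N <= j)%nat -> trunc N rho j = 0.
Proof. intros H. unfold trunc. destruct (Nat.ltb_spec j N); [lia|reflexivity]. Qed.

Lemma trunc_nonneg (N : nat) (rho : nat -> R) (j : nat) :
  (forall i, 0 < rho i) -> 0 <= trunc N rho j.
Proof. intros H. unfold trunc. destruct (Nat.ltb j N); [apply Rlt_le, H|lra]. Qed.

Lemma trunc_bound (N : nat) (rho : nat -> R) (M : R) :
  harmonic_bound rho M -> harmonic_bound (trunc N rho) M.
Proof.
  intros [HM H]. split; [exact HM|]. intros j. unfold trunc. destruct (Nat.ltb j N); [apply H|].
  rewrite Rabs_R0. pose proof (pos_INR j). apply Rdiv_le_0_compat; lra.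
Qed.

Lemma Series_trunc (N : nat) (rho w : nat -> R) :
  Series (fun j => trunc N rho j / w j) = Psum (fun j => rho j / w j) N.
Proof.
  apply Series_of_lim. apply is_lim_seq_ext_loc with (fun _ => Psum (fun j => rho j / w j) N);
    [|apply is_lim_seq_const].
  exists N. intros n Hn. replace n with (N + (n - N))%nat by lia. rewrite Psum_app.
  rewrite (Psum_ext (fun k => trunc N rho (N + k) / w (N + k)%nat) (fun _ => 0)).
  2:{ intros k Hk. rewrite trunc_ge by lia. unfold Rdiv. ring. }
  rewrite Psum_const, Rmult_0_r, Rplus_0_r.
  apply Psum_ext. intros k Hk. rewrite trunc_lt by lia. reflexivity.
Qed.

Lemma Ssum_trunc (N : nat) (rho : nat -> R) (z : R) :
  Ssum (trunc N rho) z = Psum (fun j => rho j / (z + INR j)) N.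
Proof. exact (Series_trunc N rho (fun j => z + INR j)). Qed.

Definition moment1 (rho : nat -> R) : R := Ssum (drop 0 rho) 0.
Definition moment2 (rho : nat -> R) : R := Series (fun j => drop 0 rho j / INR j ^ 2).

(* The second coefficient (see [NJet]) of [z * Ssum rho z / rho 0] at 0. *)
Definition power_sum (rho : nat -> R) : R :=
  (moment1 rho / rho O) ^ 2 + 2 * (moment2 rho / rho O).

(** Multiplication by [z] removes the pole at 0 and leaves [1 + (m1 z - m2 z^2) / rho 0 + O(z^3)],
    with [m1], [m2] the two moments. Solving [(e^2 - s)/2 = - m2 / rho 0] for [s] gives
    [power_sum]. *)
Lemma njet_Ssum (rho : nat -> R) (M : R) :
  harmonic_bound rho M -> rho O <> 0 ->
  NJet (fun z => z * Ssum rho z / rho O) (moment1 rho / rho O) (power_sum rho).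
Proof.
  intros Hr H0.
  destruct (Ssum_expansion (drop 0 rho) M) as [K HK]; [apply drop_bound, Hr|reflexivity|].
  fold (moment1 rho) (moment2 rho) in HK.
  exists (Rabs (K / rho O)), (/ 2). repeat split; try lra; [apply Rabs_pos|].
  intros z Hz Hlt.
  assert (Ha : away rho z (Rabs z)).
  { pose proof (Rabs_pos_lt z Hz). split; [lra|]. intros [|j]; right.
    - simpl. rewrite Rplus_0_r. lra.
    - rewrite S_INR. pose proof (pos_INR j).
      apply Rabs_lt_between in Hlt as Hlt'. rewrite (Rabs_pos_eq (z + _)) by lra. lra. }
  rewrite (Ssum_drop 0 rho M z _ Hr Ha). simpl INR. rewrite Rplus_0_r.
  unfold power_sum.
  replace (z * (rho O / z + Ssum (drop 0 rho) z) / rho O -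
    (1 + moment1 rho / rho O * z +
     ((moment1 rho / rho O) ^ 2 - ((moment1 rho / rho O) ^ 2 + 2 * (moment2 rho / rho O))) / 2 * z ^ 2))
    with (z * / rho O * (Ssum (drop 0 rho) z - (moment1 rho - moment2 rho * z))) by (field; auto).
  rewrite !Rabs_mult.
  specialize (HK z ltac:(lra)).
  apply Rle_trans with (Rabs z * Rabs (/ rho O) * (Rabs K * Rabs z ^ 2)).
  - apply Rmult_le_compat_l; [apply Rmult_le_pos; apply Rabs_pos|].
    eapply Rle_trans; [exact HK|]. rewrite RPow_abs, (Rabs_pos_eq (z ^ 2)) by apply pow2_ge_0.
    apply Rmult_le_compat_r; [apply pow2_ge_0|apply Rle_abs].
  - unfold Rdiv. rewrite Rabs_mult. right. ring.
Qed.

Lemma power_sum_trunc_lim (rho : nat -> R) (M : R) :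
  harmonic_bound rho M -> rho O <> 0 ->
  is_lim_seq (fun n => power_sum (trunc (S n) rho)) (power_sum rho).
Proof.
  intros Hr H0.
  assert (E : forall n j, drop 0 (trunc (S n) rho) j = trunc (S n) (drop 0 rho) j).
  { intros n j. unfold drop, trunc. destruct (Nat.eqb j 0), (Nat.ltb j (S n)); reflexivity. }
  assert (Ha : away (drop 0 rho) 0 1).
  { split; [lra|]. intros [|j]; [left; reflexivity|right].
    rewrite S_INR. pose proof (pos_INR j). rewrite Rabs_pos_eq; lra. }
  assert (L1 : is_lim_seq (fun n => moment1 (trunc (S n) rho)) (moment1 rho)).
  { apply is_lim_seq_ext with (fun n => Psum (fun j => drop 0 rho j / (0 + INR j)) (S n)).
    - intros n. unfold moment1, Ssum. rewrite <- Series_trunc. apply Series_ext. intros j. rewrite E. reflexivity.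
    - apply (is_lim_seq_incr_1 (Psum (fun j => drop 0 rho j / (0 + INR j)))). apply Series_Psum.
      apply ex_Ssum with M 1; [apply drop_bound, Hr|exact Ha]. }
  assert (L2 : is_lim_seq (fun n => moment2 (trunc (S n) rho)) (moment2 rho)).
  { apply is_lim_seq_ext with (fun n => Psum (fun j => drop 0 rho j / INR j ^ 2) (S n)).
    - intros n. unfold moment2. rewrite <- (Series_trunc (S n) (drop 0 rho) (fun j => INR j ^ 2)).
      apply Series_ext. intros j. rewrite E. reflexivity.
    - apply (is_lim_seq_incr_1 (Psum (fun j => drop 0 rho j / INR j ^ 2))). apply Series_Psum.
      apply (@ex_series_le R_AbsRing R_CompleteNormedModule) with (b := fun j => Rabs (drop 0 rho j / (0 + INR j))).
      + intros [|j]; [unfold drop, Rdiv; simpl; rewrite !Rmult_0_l; apply Rle_refl|].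
        change (norm (drop 0 rho (S j) / INR (S j) ^ 2)) with (Rabs (drop 0 rho (S j) / INR (S j) ^ 2)).
        unfold Rdiv. rewrite !Rabs_mult. apply Rmult_le_compat_l; [apply Rabs_pos|].
        rewrite S_INR. pose proof (pos_INR j).
        assert (0 < (INR j + 1) ^ 2) by nra.
        rewrite !Rabs_pos_eq by (apply Rlt_le, Rinv_0_lt_compat; lra).
        apply Rinv_le_contravar; nra.
      + apply ex_series_invsq_bound with (M * (1 + (Rabs 0 + 1) / 1)).
        intros j. rewrite Rabs_Rabsolu.
        apply Ssum_term_bound; [apply drop_bound, Hr|exact Ha|lra]. }
  unfold power_sum.
  apply is_lim_seq_ext with (fun n => (moment1 (trunc (S n) rho) / rho O) * (moment1 (trunc (S n) rho) / rho O)
     + 2 * (moment2 (trunc (S n) rho) / rho O)).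
  { intros n. rewrite (trunc_lt (S n) rho 0) by lia. ring. }
  replace ((moment1 rho / rho O) ^ 2 + 2 * (moment2 rho / rho O))
    with ((moment1 rho / rho O) * (moment1 rho / rho O) + 2 * (moment2 rho / rho O)) by ring.
  apply is_lim_seq_plus'.
  - apply is_lim_seq_mult'; apply (is_lim_seq_scal_r _ (/ rho O) _ L1).
  - apply (is_lim_seq_scal_l _ 2 (moment2 rho / rho O)). apply (is_lim_seq_scal_r _ (/ rho O) _ L2).
Qed.

Lemma Pprod_ext (u v : nat -> R) (n : nat) :
  (forall k, (k < n)%nat -> u k = v k) -> Pprod u n = Pprod v n.
Proof.
  induction n as [|n IH]; intros H; simpl; [reflexivity|].
  rewrite IH by (intros; apply H; lia). rewrite H by lia. reflexivity.
Qed.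

Lemma Pprod_mult (u v : nat -> R) (n : nat) :
  Pprod (fun k => u k * v k) n = Pprod u n * Pprod v n.
Proof. induction n as [|n IH]; simpl; [ring|rewrite IH; ring]. Qed.

Lemma Pprod_incr_1 (u : nat -> R) (n : nat) :
  Pprod u (S n) = u O * Pprod (fun k => u (S k)) n.
Proof. induction n as [|n IH]; [simpl; ring|]. cbn [Pprod] in *. rewrite IH. ring. Qed.

Lemma Pprod_neq_0 (u : nat -> R) (n : nat) :
  (forall k, (k < n)%nat -> u k <> 0) -> Pprod u n <> 0.
Proof.
  induction n as [|n IH]; intros H; simpl; [lra|].
  apply Rmult_integral_contrapositive. split; [apply IH; intros; apply H; lia|apply H; lia].
Qed.

(** The sum of the first [n] fractions cleared of denominators. The recursion avoids division, so it
    is a polynomial at the poles as well. *)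
Fixpoint numerator (rho : nat -> R) (n : nat) (z : R) : R :=
  match n with
  | O => 0
  | S m => numerator rho m z * (z + INR m) + rho m * Pprod (fun j => z + INR j) m
  end.

Lemma numerator_spec (rho : nat -> R) (n : nat) (z : R) :
  (forall j, (j < n)%nat -> z + INR j <> 0) ->
  numerator rho n z = Psum (fun j => rho j / (z + INR j)) n * Pprod (fun j => z + INR j) n.
Proof.
  induction n as [|n IH]; intros H; simpl; [ring|].
  rewrite IH by (intros; apply H; lia). field. apply H. lia.
Qed.

Lemma numerator_size (rho : nat -> R) (n : nat) : poly_size n (numerator rho n).
Proof.
  assert (HP : forall m, poly_size (S m) (fun z => Pprod (fun j => z + INR j) m)).
  { induction m as [|m IH].
    - exists 1, (fun _ => 0). split; [intros x; reflexivity|intros x; simpl; ring].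
    - apply (poly_size_mult_linear (S m) (INR m) (fun z => Pprod (fun j => z + INR j) m)), IH. }
  induction n as [|n IH]; [intros x; reflexivity|].
  apply (poly_size_plus (S n) (fun z => numerator rho n z * (z + INR n))
                        (fun z => rho n * Pprod (fun j => z + INR j) n)).
  - apply poly_size_mult_linear, IH.
  - apply poly_size_scal, HP.
Qed.

Lemma gap_neq (k : nat) (z : R) (j : nat) : gap k z -> z + INR j <> 0.
Proof. intros H. destruct (gap_cases k z j H) as [[_ ?]|[_ ?]]; lra. Qed.

Lemma gap_lt (i j : nat) (x y : R) : (i < j)%nat -> gap i x -> gap j y -> y < x.
Proof.
  intros H [H1 _] [_ H2]. assert (Hj : (S i <= j)%nat) by lia.
  apply le_INR in Hj. rewrite S_INR in Hj. lra.
Qed.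

(* Both sides are the power sum of the product
   [z S(z) / rho 0 * prod (1 + z/(j+1)) = prod (1 - z/zeta k)]. *)
Lemma trunc_root_power_sum (rho : nat -> R) (M : R) (n : nat) (zeta : nat -> R) :
  harmonic_bound rho M -> rho O <> 0 ->
  (forall k, (k < n)%nat -> gap k (zeta k) /\ Ssum (trunc (S n) rho) (zeta k) = 0) ->
  Psum (fun k => / zeta k ^ 2) n = power_sum (trunc (S n) rho) + Psum invsq n.
Proof.
  intros Hr H0 Hz.
  assert (Nz : forall k, (k < n)%nat -> zeta k <> 0).
  { intros k Hk. destruct (Hz k Hk) as [[_ H] _]. pose proof (pos_INR k). lra. }
  destruct (poly_size_roots n (numerator rho (S n)) zeta (numerator_size rho (S n))) as [c Hc].
  { intros i Hi. destruct (Hz i Hi) as [Hg Hi0].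
    rewrite numerator_spec by (intros; eapply gap_neq; exact Hg).
    rewrite <- Ssum_trunc, Hi0. ring. }
  { intros i j Hij. pose proof (gap_lt i j (zeta i) (zeta j) ltac:(lia) (proj1 (Hz i ltac:(lia))) (proj1 (Hz j ltac:(lia)))). lra. }
  set (F := fun z => (z * Ssum (trunc (S n) rho) z / rho O) * Pprod (fun j => 1 + / (INR j + 1) * z) n).
  assert (JF : NJet F (moment1 (trunc (S n) rho) / rho O + Psum (fun j => / (INR j + 1)) n)
                 (power_sum (trunc (S n) rho) + Psum invsq n)).
  { pose proof (njet_Ssum (trunc (S n) rho) M (trunc_bound _ _ _ Hr)) as JS.
    rewrite (trunc_lt (S n) rho 0) in JS by lia. specialize (JS H0).
    pose proof (njet_prod (fun j => / (INR j + 1)) n) as JP.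
    cbv beta in JP. rewrite (Psum_ext (fun j => (/ (INR j + 1)) ^ 2) invsq n) in JP.
    2:{ intros j _. unfold invsq. apply pow_inv. }
    exact (njet_mult _ _ _ _ _ _ JS JP). }
  set (G := fun z => Pprod (fun k => 1 + - / zeta k * z) n).
  assert (JG : NJet G (Psum (fun k => - / zeta k) n) (Psum (fun k => / zeta k ^ 2) n)).
  { pose proof (njet_prod (fun k => - / zeta k) n) as JP.
    cbv beta in JP. rewrite (Psum_ext (fun k => (- / zeta k) ^ 2) (fun k => / zeta k ^ 2) n) in JP; [exact JP|].
    intros k Hk. field. apply Nz, Hk. }
  set (fac := Pprod (fun j => INR j + 1) n).
  assert (Hfac : fac <> 0).
  { apply Pprod_neq_0. intros k _. pose proof (pos_INR k). lra. }
  set (K := c * Pprod (fun k => - zeta k) n / (fac * rho O)).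
  (* [numerator rho (S n)] has [n + 1] coefficients and the [n] distinct roots [zeta], hence equals
     [c] times the product of the [z - zeta k]; normalising every factor to [1 + x z] collects the
     constants in [K]. *)
  assert (EFG : forall z, z <> 0 -> Rabs z < 1 -> F z = K * G z).
  { intros z Hz0 Hz1. apply Rabs_lt_between in Hz1.
    assert (NN : forall j, z + INR j <> 0).
    { intros [|j]; [simpl; lra|]. rewrite S_INR. pose proof (pos_INR j). lra. }
    specialize (Hc z). rewrite numerator_spec in Hc by (intros; apply NN).
    rewrite <- Ssum_trunc, Pprod_incr_1 in Hc.
    rewrite (Pprod_ext (fun k => z + INR (S k)) (fun k => (INR k + 1) * (1 + / (INR k + 1) * z)) n) in Hc.
    2:{ intros k _. rewrite S_INR. pose proof (pos_INR k). field. lra. }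
    rewrite Pprod_mult in Hc. fold fac in Hc.
    rewrite (Pprod_ext (fun k => z - zeta k) (fun k => - zeta k * (1 + - / zeta k * z)) n) in Hc.
    2:{ intros k Hk. field. apply Nz, Hk. }
    rewrite Pprod_mult in Hc. fold (G z) in Hc.
    simpl INR in Hc. rewrite Rplus_0_r in Hc.
    unfold F, K.
    apply Rmult_eq_reg_l with (fac * rho O); [|apply Rmult_integral_contrapositive; auto].
    replace (fac * rho O * (c * Pprod (fun k => - zeta k) n / (fac * rho O) * G z))
      with (c * (Pprod (fun k => - zeta k) n * G z)) by (field; auto).
    rewrite <- Hc. field. exact H0. }
  pose proof (jet_mult _ _ _ _ _ _ _ _ (jet_quadratic K 0 0) JG) as JK.
  apply (jet_ext _ F _ _ _ 1 ltac:(lra)) in JK.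
  2:{ intros z Hz0 Hz1. rewrite EFG by assumption. ring. }
  (* Both jets have constant term 1, which forces [K = 1] without computing [c]. *)
  destruct (jet_unique _ _ _ _ _ _ _ JK JF) as [EK _].
  assert (JF' : NJet F (Psum (fun k => - / zeta k) n) (Psum (fun k => / zeta k ^ 2) n)).
  { apply (jet_ext G F _ _ _ 1); [lra| |exact JG].
    intros z Hz0 Hz1. rewrite EFG by assumption. replace K with 1 by lra. ring. }
  exact (proj2 (njet_unique _ _ _ _ _ JF' JF)).
Qed.

(** * Convergence of the truncated zeros and of their power sums *)

Lemma Ssum_trunc_le (rho : nat -> R) (M : R) (n k : nat) (z : R) :
  harmonic_bound rho M -> (forall j, 0 < rho j) -> (k < n)%nat -> gap k z ->
  Ssum (trunc n rho) z <= Ssum rho z.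
Proof.
  intros Hr Hp Hk Hz. apply Series_le_ex.
  - intros j. destruct (Nat.ltb_spec j n) as [H|H].
    + rewrite trunc_lt by exact H. lra.
    + rewrite trunc_ge by exact H.
      destruct (gap_cases k z j Hz) as [[Hj _]|[_ Hj]]; [lia|].
      unfold Rdiv. rewrite Rmult_0_l. apply Rlt_le, Rmult_lt_0_compat; [apply Hp|].
      apply Rinv_0_lt_compat. lra.
  - eapply ex_Ssum; [apply trunc_bound, Hr|apply (gap_away _ k z Hz)].
  - eapply ex_Ssum; [exact Hr|apply (gap_away _ k z Hz)].
Qed.

(** Choice makes the zero a total function of [rho] and [k], so truncated and full sums share one
    notation; it is meaningful once residues [k] and [k + 1] are positive. *)
Definition gap_root (rho : nat -> R) (k : nat) : R :=
  epsilon (inhabits 0) (fun z => gap k z /\ Ssum rho z = 0).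

Lemma gap_root_spec (rho : nat -> R) (M : R) (k : nat) :
  harmonic_bound rho M -> 0 < rho k -> 0 < rho (S k) ->
  gap k (gap_root rho k) /\ Ssum rho (gap_root rho k) = 0.
Proof. intros Hr H1 H2. unfold gap_root. apply epsilon_spec, gap_root_exists with M; assumption. Qed.

Lemma gap_root_trunc_spec (rho : nat -> R) (M : R) (n k : nat) :
  harmonic_bound rho M -> (forall j, 0 < rho j) -> (k < n)%nat ->
  gap k (gap_root (trunc (S n) rho) k) /\ Ssum (trunc (S n) rho) (gap_root (trunc (S n) rho) k) = 0.
Proof.
  intros Hr Hp Hk. apply gap_root_spec with M.
  - apply trunc_bound, Hr.
  - rewrite trunc_lt by lia. apply Hp.
  - rewrite trunc_lt by lia. apply Hp.
Qed.

(** In gap [k] the omitted fractions are positive, so the truncated sum is at most 0 at the zero of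
    the full one; since it decreases, its own zero cannot lie further right. *)
Lemma gap_root_trunc_le (rho : nat -> R) (M : R) (n k : nat) :
  harmonic_bound rho M -> (forall j, 0 < rho j) -> (k < n)%nat ->
  gap_root (trunc (S n) rho) k <= gap_root rho k.
Proof.
  intros Hr Hp Hk.
  destruct (gap_root_spec rho M k Hr (Hp k) (Hp (S k))) as [G0 E0].
  destruct (gap_root_trunc_spec rho M n k Hr Hp Hk) as [G1 E1].
  apply Rnot_lt_le. intros H.
  pose proof (Ssum_trunc_le rho M (S n) k _ Hr Hp ltac:(lia) G0) as L.
  assert (D : Ssum (trunc (S n) rho) (gap_root (trunc (S n) rho) k) < Ssum (trunc (S n) rho) (gap_root rho k)).
  { apply Ssum_gap_decreasing with M k; try assumption.
    - apply trunc_bound, Hr.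
    - intros j. apply trunc_nonneg, Hp.
    - rewrite trunc_lt by lia. apply Hp. }
  lra.
Qed.

Lemma gap_root_trunc_lim (rho : nat -> R) (M : R) (k : nat) :
  harmonic_bound rho M -> (forall j, 0 < rho j) ->
  is_lim_seq (fun n => gap_root (trunc (S n) rho) k) (gap_root rho k).
Proof.
  intros Hr Hp.
  destruct (gap_root_spec rho M k Hr (Hp k) (Hp (S k))) as [G0 E0].
  apply is_lim_seq_spec. intros e. pose proof (cond_pos e) as He.
  (* [w] lies within [e] to the left of the limit zero; the second argument is the midpoint between
     that zero and the pole [-(k + 1)], which keeps [w] in the gap. The full sum is positive at [w],
     hence so are the late truncations, and their zeros lie between [w] and the limit. *)
  set (w := Rmax (gap_root rho k - e / 2) ((gap_root rho k - (INR k + 1)) / 2)).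
  assert (Hw : gap k w /\ w < gap_root rho k /\ gap_root rho k - e < w).
  { unfold gap in *. unfold w, Rmax. destruct (Rle_dec _ _); lra. }
  destruct Hw as (Gw & Hw1 & Hw2).
  assert (Pw : 0 < Ssum rho w).
  { rewrite <- E0. apply Ssum_gap_decreasing with M k; try assumption.
    - intros j. apply Rlt_le, Hp.
    - apply Hp. }
  assert (L : is_lim_seq (fun n => Ssum (trunc (S n) rho) w) (Ssum rho w)).
  { apply is_lim_seq_ext with (fun n => Psum (fun j => rho j / (w + INR j)) (S n)).
    - intros n. symmetry. apply Ssum_trunc.
    - apply (is_lim_seq_incr_1 (Psum (fun j => rho j / (w + INR j)))). apply Series_Psum.
      eapply ex_Ssum; [exact Hr|apply (gap_away _ k w Gw)]. }
  apply is_lim_seq_spec in L. destruct (L (mkposreal _ Pw)) as [N HN]. simpl in HN.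
  exists (N + S k)%nat. intros n Hn.
  specialize (HN n ltac:(lia)). apply Rabs_lt_between' in HN.
  pose proof (gap_root_trunc_le rho M n k Hr Hp ltac:(lia)) as U.
  destruct (gap_root_trunc_spec rho M n k Hr Hp ltac:(lia)) as [G1 E1].
  assert (Lw : w <= gap_root (trunc (S n) rho) k).
  { apply Rnot_lt_le. intros H.
    assert (D : Ssum (trunc (S n) rho) w < Ssum (trunc (S n) rho) (gap_root (trunc (S n) rho) k)).
    { apply Ssum_gap_decreasing with M k; try assumption.
      - apply trunc_bound, Hr.
      - intros j. apply trunc_nonneg, Hp.
      - rewrite trunc_lt by lia. apply Hp. }
    lra. }
  apply Rabs_lt_between'. lra.
Qed.

Lemma Psum_lim (u : nat -> nat -> R) (l : nat -> R) (m : nat) :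
  (forall k, (k < m)%nat -> is_lim_seq (fun n => u n k) (l k)) ->
  is_lim_seq (fun n => Psum (u n) m) (Psum l m).
Proof.
  induction m as [|m IH]; intros H; simpl; [apply is_lim_seq_const|].
  apply is_lim_seq_plus'; [apply IH; intros; apply H; lia|apply H; lia].
Qed.

(** A squeeze replaces an exchange of limit and sum. All zeros are negative and the truncated ones
    lie further left, so [b m] bounds the [m]-th partial sum from below. From above, that partial
    sum is the limit in [n] of the first [m] terms of [b n], and these are at most [b n]. *)
Lemma gap_roots_power_sum (rho : nat -> R) (M : R) :
  harmonic_bound rho M -> (forall j, 0 < rho j) ->
  is_series (fun k => / gap_root rho k ^ 2) (power_sum rho + PI ^ 2 / 6).
Proof.
  intros Hr Hp.
  set (zn := fun n => gap_root (trunc (S n) rho)).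
  set (b := fun n => Psum (fun k => / zn n k ^ 2) n).
  assert (Hneg : forall k, gap_root rho k < 0).
  { intros k. destruct (gap_root_spec rho M k Hr (Hp k) (Hp (S k))) as [[_ H] _]. pose proof (pos_INR k). lra. }
  assert (Lb : is_lim_seq b (power_sum rho + PI ^ 2 / 6)).
  { apply is_lim_seq_ext with (fun n => power_sum (trunc (S n) rho) + Psum invsq n).
    - intros n. symmetry. apply trunc_root_power_sum with M; [exact Hr|apply Rgt_not_eq, Hp|].
      intros k Hk. apply gap_root_trunc_spec with M; assumption.
    - apply is_lim_seq_plus'; [apply power_sum_trunc_lim with M; [exact Hr|apply Rgt_not_eq, Hp]|].
      apply is_series_Psum, basel. }
  assert (Hpos : forall z, 0 <= / z ^ 2).
  { intros z. destruct (Req_dec z 0) as [->|Nz].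
    - replace (0 ^ 2) with 0 by ring. rewrite Rinv_0. lra.
    - apply Rlt_le, Rinv_0_lt_compat. apply pow2_gt_0, Nz. }
  apply is_series_Psum.
  apply is_lim_seq_le_le with (u := b) (w := fun _ => power_sum rho + PI ^ 2 / 6); [|exact Lb|apply is_lim_seq_const].
  intros m. split.
  - unfold b. apply Psum_le. intros k Hk.
    pose proof (gap_root_trunc_le rho M m k Hr Hp Hk) as L. fold (zn m k) in L.
    specialize (Hneg k). apply Rinv_le_contravar; nra.
  - assert (Lz : is_lim_seq (fun n => Psum (fun k => / zn n k ^ 2) m) (Psum (fun k => / gap_root rho k ^ 2) m)).
    { apply Psum_lim. intros k _. specialize (Hneg k).
      pose proof (gap_root_trunc_lim rho M k Hr Hp) as L.
      apply (is_lim_seq_continuous (fun z => / z ^ 2)) in L; [exact L|].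
      apply derivable_continuous_pt. apply ex_derive_Reals_0. auto_derive. nra. }
    refine (is_lim_seq_le_loc _ _ (Finite _) (Finite _) _ Lz Lb).
    exists m. intros n Hn. apply Psum_mono; [intros; apply Hpos|exact Hn].
Qed.

(** * [psi_G] on the real line *)

(** With [H_n] the harmonic sum, [H_n - ln n] decreases because [1/(m + 1) <= ln (1 + 1/m)], while
    [H_n - ln n - 1/(2n)] increases because the trapezoid rule overestimates the integral of the
    convex function [1/x]. Their values at 1 are 1 and 1/2. *)
Lemma harmonic_minus_ln_bounds (n : nat) :
  / 2 <= Psum (fun j => / (INR j + 1)) (S n) - ln (INR (S n)) <= 1.
Proof.
  assert (H : / 2 + / (2 * INR (S n)) <= Psum (fun j => / (INR j + 1)) (S n) - ln (INR (S n)) <= 1).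
  { induction n as [|n IH].
    - simpl. rewrite ln_1, Rplus_0_l, Rplus_0_l. lra.
    - change (Psum (fun j => / (INR j + 1)) (S (S n)))
        with (Psum (fun j => / (INR j + 1)) (S n) + / (INR (S n) + 1)).
      rewrite (S_INR (S n)). set (m := INR (S n)) in *.
      assert (Hm : 1 <= m) by (unfold m; rewrite S_INR; pose proof (pos_INR n); lra).
      assert (Lm : ln (m + 1) = ln m + ln (1 + / m)).
      { rewrite <- ln_mult; [f_equal; field; lra|lra|].
        assert (0 < / m) by (apply Rinv_0_lt_compat; lra). lra. }
      assert (Pm : 0 < / m) by (apply Rinv_0_lt_compat; lra).
      assert (Lo : / (m + 1) <= ln (1 + / m)).
      { pose proof (exp_ineq1_le (ln (/ (1 + / m)))) as E.
        rewrite exp_ln in E by (apply Rinv_0_lt_compat; lra).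
        rewrite ln_Rinv in E by lra.
        replace (/ (m + 1)) with (1 - / (1 + / m)) by (field; lra). lra. }
      assert (Up : ln (1 + / m) <= (/ m + / (m + 1)) / 2).
      { destruct (MVT_gen (fun u => (u + u / (1 + u)) / 2 - ln (1 + u)) 0 (/ m)
                    (fun u => (1 - / (1 + u)) ^ 2 / 2)) as [c [Hc Ec]].
        - intros u Hu. rewrite Rmin_left, Rmax_right in Hu by lra.
          auto_derive; [lra|field; lra].
        - intros u Hu. rewrite Rmin_left, Rmax_right in Hu by lra.
          apply derivable_continuous_pt, ex_derive_Reals_0. auto_derive. lra.
        - rewrite Rplus_0_r, ln_1, Rminus_0_r in Ec.
          replace (/ (m + 1)) with (/ m / (1 + / m)) by (field; lra).
          assert (0 <= (1 - / (1 + c)) ^ 2 / 2 * / m).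
          { apply Rmult_le_pos; [|lra]. pose proof (pow2_ge_0 (1 - / (1 + c))). lra. }
          lra. }
      rewrite Lm.
      replace (/ (2 * m)) with (/ m / 2) in IH by (field; lra).
      replace (/ (2 * (m + 1))) with (/ (m + 1) / 2) by (field; lra).
      lra. }
  assert (0 < / (2 * INR (S n))).
  { apply Rinv_0_lt_compat. rewrite S_INR. pose proof (pos_INR n). lra. }
  lra.
Qed.

(** [Lim_seq] is total and monotone, so bounds valid from [n = 1] on suffice: they also rule out
    infinite values, and convergence need not be shown. *)
Lemma euler_gamma_bounds : / 2 <= euler_gamma <= 1.
Proof.
  unfold euler_gamma.
  set (u := fun n => sum_n_m (fun k => / INR k) 1 n - ln (INR n)).
  assert (B : eventually (fun n => / 2 <= u n <= 1)).
  { exists 1%nat. intros [|n] Hn; [lia|]. unfold u.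
    rewrite <- sum_n_m_S. change (sum_n_m (fun n0 => / INR (S n0)) 0 n) with (sum_n (fun n0 => / INR (S n0)) n).
    rewrite sum_n_Psum.
    rewrite (Psum_ext _ (fun j => / (INR j + 1))) by (intros; rewrite S_INR; reflexivity).
    apply harmonic_minus_ln_bounds. }
  pose proof (Lim_seq_le_loc (fun _ => / 2) u) as H1.
  pose proof (Lim_seq_le_loc u (fun _ => 1)) as H2.
  rewrite Lim_seq_const in H1, H2.
  specialize (H1 ltac:(revert B; apply filter_imp; tauto)).
  specialize (H2 ltac:(revert B; apply filter_imp; tauto)).
  destruct (Lim_seq u); simpl in *; try tauto.
Qed.

Lemma ln_2PI_bounds : 1 < ln (2 * PI) < 2.
Proof.
  pose proof PI2_3_2 as H3.
  (* The first term of the alternating series for [PI/4 = 2 atan (1/3) + atan (1/7)] gives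
     [PI <= 4 (2/3 + 1/7) = 68/21]. *)
  assert (HP : PI <= 3.24).
  { pose proof (proj2 (PI_2_3_7_ineq 0)) as H. simpl in H. unfold tg_alt, PI_2_3_7_tg, Ratan_seq in H. simpl in H. lra. }
  split.
  - rewrite <- (ln_exp 1) at 1. apply ln_increasing; [apply exp_pos|]. pose proof exp_le_3. lra.
  - apply Rlt_le_trans with (ln (exp 2)); [|rewrite ln_exp; lra].
    apply ln_increasing; [lra|].
    (* [exp 2 >= (1 + 1/8)^16 > 6.58], which just exceeds [2 * 3.24]. *)
    replace (exp 2) with (exp (/ 8) ^ 16).
    + apply Rlt_le_trans with ((9 / 8) ^ 16); [lra|].
      apply pow_incr. pose proof (exp_ineq1_le (/ 8)). lra.
    + simpl. rewrite Rmult_1_r, <- !exp_plus. f_equal. lra.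
Qed.

Definition sigma (j : nat) : R := / (INR j + 1).

Lemma sigma_bound : harmonic_bound sigma 1.
Proof.
  split; [lra|]. intros j. unfold sigma. pose proof (pos_INR j).
  rewrite Rabs_pos_eq by (apply Rlt_le, Rinv_0_lt_compat; lra). lra.
Qed.

(** Obtained from the closed form of [psi_G] by inserting [psi z = - gamma + (z - 1) sum_j 1/((j +
    1) (z + j))]. *)
Definition psiG_real (z : R) : R :=
  (ln (2 * PI) - 1) / 2 - (1 + euler_gamma) * (z - 1) + (z - 1) ^ 2 * Ssum sigma z.

Lemma pos_away (rho : nat -> R) (z : R) : 0 < z -> away rho z z.
Proof.
  intros Hz. split; [exact Hz|]. intros j. right. pose proof (pos_INR j). rewrite Rabs_pos_eq; lra.
Qed.

Lemma psiG_real_continuous (z d : R) : away sigma z d -> continuity_pt psiG_real z.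
Proof.
  intros Hz. unfold psiG_real.
  apply continuity_pt_plus.
  - apply derivable_continuous_pt, ex_derive_Reals_0. auto_derive. trivial.
  - apply continuity_pt_mult.
    + apply derivable_continuous_pt, ex_derive_Reals_0. auto_derive. trivial.
    + apply Ssum_continuous with 1 d; [apply sigma_bound|exact Hz].
Qed.

(** The series is both the value of [Ssum sigma] at 2 and the first moment of [sigma]. *)
Lemma telescoping_series : is_series (fun j => / ((INR j + 1) * (INR j + 2))) 1.
Proof.
  apply is_series_Psum. apply is_lim_seq_ext with (fun n => 1 - / (INR n + 1)).
  - induction n as [|n IH]; [simpl; field|].
    cbn [Psum]. rewrite <- IH, S_INR. pose proof (pos_INR n). field. lra.
  - replace (Finite 1) with (Finite (1 - 0)) by (f_equal; ring).
    apply is_lim_seq_minus'; [apply is_lim_seq_const|].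
    replace (Finite 0) with (Rbar_inv p_infty) by reflexivity.
    apply is_lim_seq_inv; [|discriminate].
    apply is_lim_seq_ext with (fun n => INR (S n)); [intros; apply S_INR|].
    apply (is_lim_seq_incr_1 INR), is_lim_seq_INR.
Qed.

(** Sign changes at 1, 2 and 11. At 2 the value is [(log (2 pi) - 1)/2 - gamma], negative because
    [log (2 pi) < 2] and [gamma >= 1/2]. At 11, [gamma <= 1] bounds the linear loss by 20, and
    [Ssum sigma 11 > 1/5] makes the quadratic term exceed it. *)
Lemma psiG_real_roots : exists p q, 1 < q < 2 /\ 2 < p < 11 /\ psiG_real p = 0 /\ psiG_real q = 0.
Proof.
  pose proof euler_gamma_bounds as Hg. pose proof ln_2PI_bounds as HL.
  assert (F1 : 0 < psiG_real 1) by (unfold psiG_real; rewrite Rminus_diag; lra).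
  assert (F2 : psiG_real 2 < 0).
  { unfold psiG_real, Ssum.
    rewrite (Series_ext _ (fun j => / ((INR j + 1) * (INR j + 2)))).
    - rewrite (is_series_unique _ _ telescoping_series). lra.
    - intros j. unfold sigma. pose proof (pos_INR j). field. lra. }
  assert (F11 : 0 < psiG_real 11).
  { assert (S11 : / 5 < Ssum sigma 11).
    { apply Rlt_le_trans with (Psum (fun j => sigma j / (11 + INR j)) 8).
      - unfold sigma. simpl. lra.
      - apply Psum_le_Series.
        + intros j. unfold sigma. pose proof (pos_INR j). apply Rdiv_le_0_compat; [|lra].
          apply Rlt_le, Rinv_0_lt_compat. lra.
        + apply ex_Ssum with 1 11; [apply sigma_bound|apply pos_away; lra]. }
    unfold psiG_real. lra. }
  destruct (Ranalysis5.IVT_interv psiG_real 2 11) as [p [Hp Ep]]; [|lra|exact F2|exact F11|].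
  { intros a Ha. apply psiG_real_continuous with a, pos_away. lra. }
  destruct (Ranalysis5.IVT_interv (fun z => - psiG_real z) 1 2) as [q [Hq Eq]]; [|lra|lra|lra|].
  { intros a Ha. apply continuity_pt_opp, psiG_real_continuous with a, pos_away. lra. }
  exists p, q.
  assert (p <> 2) by (intros ->; lra). assert (p <> 11) by (intros ->; lra).
  assert (q <> 1) by (intros ->; lra). assert (q <> 2) by (intros ->; lra).
  lra.
Qed.

(** * Division of [psi_G] by its two positive zeros, and the expansion at 0 *)

(** [(z - 1)^2 / ((j + 1) (z + j))] is affine in [z] plus [(j + 1)/(z + j)]; dividing the residue
    [j + 1] by [(z - p) (z - q)] at [z = -j] gives this value. *)
Definition residue (p q : R) (j : nat) : R := (INR j + 1) / ((INR j + p) * (INR j + q)).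

Lemma residue_pos (p q : R) (j : nat) : 0 < p -> 0 < q -> 0 < residue p q j.
Proof.
  intros Hp Hq. pose proof (pos_INR j). apply Rdiv_lt_0_compat; [lra|apply Rmult_lt_0_compat; lra].
Qed.

Lemma residue_bound (p q : R) : 1 < p -> 1 < q -> harmonic_bound (residue p q) 1.
Proof.
  intros Hp Hq. split; [lra|]. intros j. pose proof (pos_INR j).
  rewrite Rabs_pos_eq by (apply Rlt_le, residue_pos; lra).
  unfold residue. apply Rmult_le_reg_r with ((INR j + p) * (INR j + q)); [nra|].
  replace ((INR j + 1) / ((INR j + p) * (INR j + q)) * ((INR j + p) * (INR j + q)))
    with (INR j + 1) by (field; lra).
  apply Rmult_le_reg_r with (INR j + 1); [lra|].
  replace (1 / (INR j + 1) * ((INR j + p) * (INR j + q)) * (INR j + 1))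
    with ((INR j + p) * (INR j + q)) by (field; lra). nra.
Qed.

(* The second divided difference at [z, p, q] annihilates affine functions and sends
   [1/(x + j)] to [1/((z + j) (p + j) (q + j))]. *)
Lemma psiG_real_factor (p q z d : R) :
  1 < p -> 1 < q -> p <> q -> psiG_real p = 0 -> psiG_real q = 0 ->
  0 < d -> (forall j, d <= Rabs (z + INR j)) ->
  psiG_real z = (z - p) * (z - q) * Ssum (residue p q) z.
Proof.
  intros Hp Hq Hpq Ep Eq Hd Hz.
  assert (Az : forall rho, away rho z d) by (intros rho; split; auto).
  pose proof (ex_Ssum sigma 1 z d sigma_bound (Az _)) as Xz.
  pose proof (ex_Ssum sigma 1 p p sigma_bound (pos_away _ p ltac:(lra))) as Xp.
  pose proof (ex_Ssum sigma 1 q q sigma_bound (pos_away _ q ltac:(lra))) as Xq.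
  pose proof (fun c => ex_series_scal_l c _ Xz : ex_series (fun j => c * (sigma j / (z + INR j)))) as Yz.
  pose proof (fun c => ex_series_scal_l c _ Xp : ex_series (fun j => c * (sigma j / (p + INR j)))) as Yp.
  pose proof (fun c => ex_series_scal_l c _ Xq : ex_series (fun j => c * (sigma j / (q + INR j)))) as Yq.
  assert (E : (p - q) * ((z - p) * (z - q) * Ssum (residue p q) z)
     = (p - q) * (z - 1) ^ 2 * Ssum sigma z - (z - q) * (p - 1) ^ 2 * Ssum sigma p
       + (z - p) * (q - 1) ^ 2 * Ssum sigma q).
  { replace ((p - q) * ((z - p) * (z - q) * Ssum (residue p q) z))
      with ((p - q) * (z - p) * (z - q) * Ssum (residue p q) z) by ring.
    unfold Ssum. rewrite <- !Series_scal_l.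
    rewrite <- Series_minus; [|exact (Yz _)|exact (Yp _)].
    rewrite <- Series_plus; [| |exact (Yq _)].
    2:{ apply (@ex_series_minus R_AbsRing R_NormedModule);
        [exact (Yz _)|exact (Yp _)]. }
    apply Series_ext. intros j. unfold sigma, residue. pose proof (pos_INR j).
    assert (z + INR j <> 0) by (intros Z; specialize (Hz j); rewrite Z, Rabs_R0 in Hz; lra).
    field. repeat split; lra. }
  apply Rmult_eq_reg_l with (p - q); [|lra]. rewrite E.
  unfold psiG_real in *.
  set (A := (ln (2 * PI) - 1) / 2) in *. set (g := 1 + euler_gamma) in *.
  replace ((p - 1) ^ 2 * Ssum sigma p) with (- (A - g * (p - 1))) by lra.
  rewrite !Rmult_assoc.
  replace ((p - 1) ^ 2 * Ssum sigma p) with (- (A - g * (p - 1))) by lra.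
  replace ((q - 1) ^ 2 * Ssum sigma q) with (- (A - g * (q - 1))) by lra.
  ring.
Qed.

Lemma jet_plus_quadratic (f : R -> R) (a b c a' b' c' : R) :
  Jet f a b c -> Jet (fun z => a' + b' * z + c' * z ^ 2 + f z) (a' + a) (b' + b) (c' + c).
Proof.
  intros (M & d & Hd & HM & Hf). exists M, d. repeat split; try lra.
  intros z Hz Hlt. specialize (Hf z Hz Hlt).
  replace (a' + b' * z + c' * z ^ 2 + f z - (a' + a + (b' + b) * z + (c' + c) * z ^ 2))
    with (f z - (a + b * z + c * z ^ 2)) by ring. exact Hf.
Qed.

Lemma jet_coef (f : R -> R) (a b c a' b' c' : R) :
  a = a' -> b = b' -> c = c' -> Jet f a b c -> Jet f a' b' c'.
Proof. intros -> -> ->. trivial. Qed.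

Lemma moment1_sigma : moment1 sigma = 1.
Proof.
  unfold moment1, Ssum. rewrite Series_incr_1_aux by (unfold drop, Rdiv; simpl; ring).
  rewrite <- (is_series_unique _ _ telescoping_series). apply Series_ext. intros j.
  unfold drop, sigma. cbn [Nat.eqb]. rewrite S_INR. pose proof (pos_INR j). field. lra.
Qed.

Lemma moment2_sigma : moment2 sigma = PI ^ 2 / 6 - 1.
Proof.
  unfold moment2. rewrite Series_incr_1_aux by (unfold drop, Rdiv; simpl; ring).
  rewrite <- (is_series_unique _ _ telescoping_series), <- (is_series_unique _ _ basel).
  rewrite <- Series_minus; [|exists (PI ^ 2 / 6); exact basel|exists 1; exact telescoping_series].
  apply Series_ext. intros j.
  unfold drop, sigma, invsq. cbn [Nat.eqb]. rewrite S_INR. pose proof (pos_INR j). field. lra.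
Qed.

Lemma njet_psiG_real :
  NJet (fun z => z * psiG_real z) ((ln (2 * PI) - 1) / 2 + euler_gamma)
       (((ln (2 * PI) - 1) / 2 + euler_gamma) ^ 2 + 2 * (1 + euler_gamma + PI ^ 2 / 6)).
Proof.
  assert (S0 : sigma 0 = 1) by (unfold sigma; simpl; field).
  pose proof (njet_Ssum sigma 1 sigma_bound ltac:(rewrite S0; lra)) as J.
  unfold power_sum in J. rewrite moment1_sigma, moment2_sigma, S0 in J.
  pose proof (jet_mult _ _ _ _ _ _ _ _ (jet_quadratic 1 (-2) 1) J) as J2.
  set (A := (ln (2 * PI) - 1) / 2). set (g := euler_gamma).
  pose proof (jet_plus_quadratic _ _ _ _ 0 (A + 1 + g) (- (1 + g)) J2) as J3.
  eapply jet_coef; [| | |eapply jet_ext with (3 := J3) (d := 1)]; [field|field|field|lra|].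
  intros z _ _. unfold psiG_real. fold A g. field.
Qed.

(** As [residue p q 0 = 1/(p q)], the factorisation reads [z psi_G z = (1 - z/p) (1 - z/q) (z S z /
    residue p q 0)], and power sums add over the factors. *)
Lemma power_sum_residue (p q : R) :
  1 < p -> 1 < q -> p <> q -> psiG_real p = 0 -> psiG_real q = 0 ->
  / p ^ 2 + / q ^ 2 + power_sum (residue p q) =
  ((ln (2 * PI) - 1) / 2 + euler_gamma) ^ 2 + 2 * (1 + euler_gamma + PI ^ 2 / 6).
Proof.
  intros Hp Hq Hpq Ep Eq.
  pose proof (residue_pos p q 0 ltac:(lra) ltac:(lra)) as R0.
  pose proof (njet_Ssum (residue p q) 1 (residue_bound p q Hp Hq) ltac:(lra)) as J.
  assert (L : forall x, x <> 0 -> NJet (fun z => 1 + - / x * z) (- / x) (/ x ^ 2)).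
  { intros x Hx. apply jet_ext with (f := fun z => 1 + - / x * z + ((- / x) ^ 2 - / x ^ 2) / 2 * z ^ 2) (d := 1);
      [lra| |apply jet_quadratic].
    intros z _ _. field. exact Hx. }
  pose proof (njet_mult _ _ _ _ _ _ (L p ltac:(lra)) (njet_mult _ _ _ _ _ _ (L q ltac:(lra)) J)) as J2.
  apply (jet_ext _ (fun z => z * psiG_real z) _ _ _ 1 ltac:(lra)) in J2.
  - pose proof (proj2 (njet_unique _ _ _ _ _ J2 njet_psiG_real)). lra.
  - intros z Hz Hlt. apply Rabs_lt_between in Hlt.
    rewrite (psiG_real_factor p q z (Rmin (Rabs z) (1 + z))); try assumption.
    + unfold residue at 2. simpl INR. field. lra.
    + apply Rmin_glb_lt; [apply Rabs_pos_lt, Hz|lra].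
    + intros [|j].
      * simpl. rewrite Rplus_0_r. apply Rmin_l.
      * rewrite S_INR. pose proof (pos_INR j). eapply Rle_trans; [apply Rmin_r|].
        rewrite Rabs_pos_eq; lra.
Qed.

(** * Barnes' product on the real line *)

Definition real_factor (x : R) (j : nat) : R :=
  (1 + (x - 1) / INR (S j)) ^ S j * exp ((x - 1) ^ 2 / (2 * INR (S j)) - (x - 1)).

Definition barnes_real (x : R) : R :=
  exp ((x - 1) / 2 * ln (2 * PI)) * exp (- ((x - 1) + (1 + euler_gamma) * (x - 1) ^ 2) / 2)
  * real (Lim_seq (Pprod (real_factor x))).

Lemma Cexp_RtoC (t : R) : Cexp (RtoC t) = RtoC (exp t).
Proof. unfold Cexp, RtoC. simpl. rewrite cos_0, sin_0. f_equal; ring. Qed.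

Lemma barnes_factor_RtoC (x : R) (j : nat) :
  barnes_factor (RtoC x - 1)%C (S j) = RtoC (real_factor x j).
Proof.
  assert (Hj : INR (S j) <> 0) by (apply not_0_INR; lia).
  unfold barnes_factor, real_factor.
  rewrite <- !RtoC_minus, <- RtoC_div, <- !RtoC_plus, <- !RtoC_pow, <- RtoC_mult, <- RtoC_div, <- RtoC_minus.
  - rewrite Cexp_RtoC, <- RtoC_mult. reflexivity.
  - lra.
  - exact Hj.
Qed.

Lemma Cprod_RtoC (f : nat -> C) (g : nat -> R) (n : nat) :
  (forall j, f j = RtoC (g j)) -> Cprod f n = RtoC (Pprod g n).
Proof. intros H. induction n as [|n IH]; simpl; [reflexivity|]. rewrite IH, H, <- RtoC_mult. reflexivity. Qed.

Lemma BarnesG_RtoC (x : R) : BarnesG (RtoC x) = RtoC (barnes_real x).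
Proof.
  unfold BarnesG, barnes_real. cbv zeta.
  assert (E : CLim_seq (Cprod (fun j => barnes_factor (RtoC x - 1)%C (S j)))
     = RtoC (real (Lim_seq (Pprod (real_factor x))))).
  { unfold CLim_seq, RtoC. f_equal.
    - f_equal. apply Lim_seq_ext. intros n. rewrite (Cprod_RtoC _ (real_factor x)); [reflexivity|].
      apply barnes_factor_RtoC.
    - rewrite (Lim_seq_ext _ (fun _ => 0)); [rewrite Lim_seq_const; reflexivity|].
      intros n. rewrite (Cprod_RtoC _ (real_factor x)); [reflexivity|]. apply barnes_factor_RtoC. }
  rewrite E.
  rewrite <- !RtoC_minus, <- !RtoC_div by lra. rewrite <- !RtoC_pow, <- !RtoC_plus, <- !RtoC_mult, <- !RtoC_plus,
    <- RtoC_opp, <- RtoC_div by lra. rewrite !Cexp_RtoC, <- !RtoC_mult. reflexivity.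
Qed.

(* [log_ratio y x j] is the logarithm of [real_factor x j / real_factor y j], and [slope] its
   derivative in [x]. *)
Definition log_ratio (y x : R) (j : nat) : R :=
  (INR j + 1) * ln ((x + INR j) / (y + INR j)) + ((x - 1) ^ 2 - (y - 1) ^ 2) / (2 * (INR j + 1)) - (x - y).

Definition slope (x : R) (j : nat) : R := (x - 1) ^ 2 * (sigma j / (x + INR j)).

Lemma real_factor_eq (x : R) (j : nat) :
  real_factor x j = ((x + INR j) / (INR j + 1)) ^ S j * exp ((x - 1) ^ 2 / (2 * (INR j + 1)) - (x - 1)).
Proof.
  unfold real_factor. rewrite S_INR. pose proof (pos_INR j). f_equal. f_equal. field. lra.
Qed.

Lemma same_sign_ratio (a b : R) : 0 < a * b -> 0 < a / b.
Proof.
  intros H. assert (b <> 0) by (intros ->; lra).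
  replace (a / b) with (a * b * (/ b) ^ 2) by (field; assumption).
  apply Rmult_lt_0_compat; [exact H|]. apply pow2_gt_0. apply Rinv_neq_0_compat. assumption.
Qed.

(** To the left of 0 single factors may be negative and have no logarithm. Comparison with a point
    [y] on the same side of [-j] makes the quotient positive. *)
Lemma real_factor_ratio (x y : R) (j : nat) :
  0 < (x + INR j) * (y + INR j) -> real_factor x j = real_factor y j * exp (log_ratio y x j).
Proof.
  intros H. rewrite !real_factor_eq. unfold log_ratio. pose proof (pos_INR j).
  assert (Hy : y + INR j <> 0) by (intros E; rewrite E in H; lra).
  pose proof (same_sign_ratio _ _ H) as Hr.
  replace ((INR j + 1) * ln ((x + INR j) / (y + INR j)) + ((x - 1) ^ 2 - (y - 1) ^ 2) / (2 * (INR j + 1)) - (x - y))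
    with (INR (S j) * ln ((x + INR j) / (y + INR j))
          + (((x - 1) ^ 2 / (2 * (INR j + 1)) - (x - 1)) + - ((y - 1) ^ 2 / (2 * (INR j + 1)) - (y - 1))))
    by (rewrite S_INR; field; lra).
  rewrite !exp_plus, exp_Ropp.
  fold (Rpower ((x + INR j) / (y + INR j)) (INR (S j))). rewrite Rpower_pow by exact Hr.
  replace (((x + INR j) / (INR j + 1)) ^ S j)
    with (((y + INR j) / (INR j + 1)) ^ S j * ((x + INR j) / (y + INR j)) ^ S j).
  - field. apply Rgt_not_eq, exp_pos.
  - rewrite <- Rpow_mult_distr. f_equal. field. lra.
Qed.

(** The derivative [(j + 1)/(t + j) + (t - 1)/(j + 1) - 1] collapses to
    [(t - 1)^2 / ((j + 1) (t + j))]: the exponential factors of the product are what makes it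
    summable in [j]. *)
Lemma log_ratio_mvt (x y : R) (j : nat) :
  0 < (x + INR j) * (y + INR j) ->
  exists c, Rmin y x <= c <= Rmax y x /\ log_ratio y x j = (x - y) * slope c j.
Proof.
  intros H. pose proof (pos_INR j).
  assert (Hy : y + INR j <> 0) by (intros E; rewrite E in H; lra).
  assert (Hc : forall c, Rmin y x <= c <= Rmax y x -> 0 < (c + INR j) * (y + INR j)).
  { intros c. unfold Rmin, Rmax. destruct (Rle_dec y x); intros Hc.
    - destruct (Rlt_le_dec 0 (y + INR j)); nra.
    - destruct (Rlt_le_dec 0 (y + INR j)); [|nra].
      assert (0 < x + INR j) by nra. nra. }
  assert (D : forall c, Rmin y x <= c <= Rmax y x -> is_derive (fun t => log_ratio y t j) c (slope c j)).
  { intros c Hc'. specialize (Hc c Hc'). pose proof (same_sign_ratio _ _ Hc) as Hr.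
    assert (c + INR j <> 0) by (intros E; rewrite E in Hc; lra).
    unfold log_ratio, slope, sigma. auto_derive; [exact Hr|]. field. repeat split; lra. }
  destruct (MVT_gen (fun t => log_ratio y t j) y x (fun c => slope c j)) as [c [Hc' E]].
  - intros t Ht. apply D. lra.
  - intros t Ht. apply derivable_continuous_pt, ex_derive_Reals_0. exists (slope t j). apply D, Ht.
  - exists c. split; [exact Hc'|].
    replace (log_ratio y y j) with 0 in E; [lra|].
    unfold log_ratio. replace ((y + INR j) / (y + INR j)) with 1 by (field; exact Hy).
    rewrite ln_1. field. lra.
Qed.

Definition off_poles (y d : R) : Prop := 0 < d /\ forall j, d <= Rabs (y + INR j).

Lemma off_poles_away (rho : nat -> R) (y d : R) : off_poles y d -> away rho y d.
Proof. intros [Hd H]. split; [exact Hd|]. intros j. right. apply H. Qed.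

Lemma off_poles_exists (y : R) : (forall n, y <> - INR n) -> exists d, off_poles y d.
Proof.
  intros H. destruct (Rlt_le_dec 0 y) as [Hy|Hy].
  - exists y. split; [exact Hy|]. intros j. pose proof (pos_INR j). rewrite Rabs_pos_eq; lra.
  - destruct (nfloor_ex (- y)) as [n Hn]; [lra|].
    assert (G : gap n y) by (unfold gap; specialize (H n); lra).
    destruct (gap_away (fun _ => 1) n y G) as [Hd Ha].
    eexists. split; [exact Hd|]. intros j. destruct (Ha j) as [E|E]; [lra|exact E].
Qed.

Lemma gap_off_integers (k : nat) (y : R) (n : nat) : gap k y -> y <> - INR n.
Proof. intros G E. apply (gap_neq k y n G). rewrite E. ring. Qed.

Lemma between_dist (x y c : R) : Rmin y x <= c <= Rmax y x -> Rabs (c - y) <= Rabs (x - y).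
Proof.
  unfold Rmin, Rmax. destruct (Rle_dec y x); intros H.
  - rewrite !Rabs_pos_eq; lra.
  - rewrite !Rabs_left1; lra.
Qed.

Lemma off_poles_same_sign (x y d : R) (j : nat) :
  off_poles y d -> Rabs (x - y) <= d / 2 -> 0 < (x + INR j) * (y + INR j).
Proof.
  intros [Hd H] Hx. specialize (H j). apply Rabs_le_between in Hx.
  unfold Rabs in H. destruct (Rcase_abs (y + INR j)); nra.
Qed.

Lemma log_ratio_expansion (y d : R) :
  off_poles y d ->
  exists K, 0 <= K /\ forall x j, Rabs (x - y) <= d / 2 ->
    Rabs (log_ratio y x j - (x - y) * slope y j) <= K * (x - y) ^ 2 * invsq j.
Proof.
  intros Hy. pose proof Hy as [Hd _].
  set (B := Rabs y + d / 2).
  assert (HB : 0 < B) by (unfold B; pose proof (Rabs_pos y); lra).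
  set (K1 := 1 * (1 + (B + 1) / (d / 2)) ^ 2). set (K2 := 1 * (1 + (B + 1) / d)).
  assert (P1 : 0 <= K1) by (unfold K1; pose proof (pow2_ge_0 (1 + (B + 1) / (d / 2))); lra).
  assert (P2 : 0 <= K2) by (unfold K2; assert (0 < (B + 1) / d) by (apply Rdiv_lt_0_compat; lra); lra).
  exists ((B + 1) ^ 2 * K1 + (2 * B + 2) * K2). split.
  { pose proof (pow2_ge_0 (B + 1)). assert (0 <= (B + 1) ^ 2 * K1) by (apply Rmult_le_pos; lra).
    assert (0 <= (2 * B + 2) * K2) by (apply Rmult_le_pos; lra). lra. }
  intros x j Hx.
  destruct (log_ratio_mvt x y j (off_poles_same_sign x y d j Hy Hx)) as [c [Hc E]].
  rewrite E. clear E. apply between_dist in Hc.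
  pose proof (off_poles_away sigma y d Hy) as Ay.
  pose proof (away_near sigma c y d Ay ltac:(lra)) as Ac.
  assert (Ay2 : away sigma y (d / 2)).
  { apply away_near with y; [exact Ay|]. rewrite Rminus_diag, Rabs_R0. lra. }
  assert (By : Rabs y <= B) by (unfold B; lra).
  assert (Bc : Rabs c <= B) by (unfold B; pose proof (Rabs_triang_inv c y); lra).
  pose proof (Ssum_diff_term sigma 1 c y (d / 2) B j sigma_bound Ac Ay2 Bc By) as D1. fold K1 in D1.
  pose proof (Ssum_term_bound sigma 1 y d B j sigma_bound Ay By) as D2. fold K2 in D2.
  unfold slope. set (sc := sigma j / (c + INR j)) in *. set (sy := sigma j / (y + INR j)) in *.
  pose proof (invsq_pos j) as Hi. set (v := invsq j) in *. set (t := Rabs (x - y)) in *.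
  assert (Ht : 0 <= t) by apply Rabs_pos.
  (* The mean value theorem reduces the remainder to [slope c - slope y]. Its two parts, from the
     fraction and from the square, are each at most a multiple of [|c - y| <= |x - y|]. *)
  replace ((x - y) * ((c - 1) ^ 2 * sc) - (x - y) * ((y - 1) ^ 2 * sy))
    with ((x - y) * ((c - 1) ^ 2 * (sc - sy) + (c - y) * (c + y - 2) * sy)) by ring.
  rewrite Rabs_mult. fold t.
  replace ((x - y) ^ 2) with (t * t).
  2:{ unfold t. rewrite <- Rabs_mult, Rabs_pos_eq; [ring|]. replace ((x - y) * (x - y)) with ((x - y) ^ 2) by ring. apply pow2_ge_0. }
  replace (((B + 1) ^ 2 * K1 + (2 * B + 2) * K2) * (t * t) * v)
    with (t * ((B + 1) ^ 2 * (K1 * t * v) + t * (2 * B + 2) * (K2 * v))) by ring.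
  apply Rmult_le_compat_l; [exact Ht|].
  eapply Rle_trans; [apply Rabs_triang|]. apply Rabs_le_between in Bc. apply Rabs_le_between in By.
  apply Rplus_le_compat.
  - rewrite Rabs_mult. apply Rmult_le_compat; try apply Rabs_pos.
    + rewrite Rabs_pos_eq by apply pow2_ge_0. nra.
    + eapply Rle_trans; [exact D1|]. apply Rmult_le_compat_r; [lra|]. apply Rmult_le_compat_l; [exact P1|exact Hc].
  - rewrite !Rabs_mult. apply Rmult_le_compat; try apply Rabs_pos; [| |exact D2].
    + rewrite <- Rabs_mult. apply Rabs_pos.
    + apply Rmult_le_compat; try apply Rabs_pos; [exact Hc|].
      apply Rabs_le. lra.
Qed.

Lemma Pprod_exp (g l : nat -> R) (h : nat -> R) (n : nat) :
  (forall j, (j < n)%nat -> g j = h j * exp (l j)) -> Pprod g n = Pprod h n * exp (Psum l n).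
Proof.
  induction n as [|n IH]; intros H; simpl; [rewrite exp_0; ring|].
  rewrite IH by (intros; apply H; lia). rewrite H by lia. rewrite exp_plus. ring.
Qed.

Lemma lim_exp (u : nat -> R) (l : R) : is_lim_seq u l -> is_lim_seq (fun n => exp (u n)) (exp l).
Proof.
  apply is_lim_seq_continuous. apply derivable_continuous_pt, derivable_pt_exp.
Qed.

(** The first [J] factors, possibly negative, stay outside the exponential; the tail is the
    exponential of an absolutely convergent series, hence not 0. *)
Lemma infinite_product_converges (g l : nat -> R) (J : nat) (M : R) :
  (forall j, g j <> 0) ->
  (forall j, (J <= j)%nat -> g j = exp (l j) /\ Rabs (l j) <= M * invsq j) ->
  exists P, P <> 0 /\ is_lim_seq (Pprod g) P.
Proof.
  intros Hg Hl.
  set (l' := fun j => if Nat.ltb j J then 0 else l j).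
  set (h := fun j => if Nat.ltb j J then g j else 1).
  assert (HM : 0 <= M).
  { destruct (Hl J (le_n J)) as [_ H]. pose proof (Rabs_pos (l J)). pose proof (invsq_pos J).
    apply Rmult_le_reg_r with (invsq J); lra. }
  assert (Ex : ex_series l').
  { apply ex_series_invsq_bound with M. intros j. unfold l'. destruct (Nat.ltb_spec j J) as [H|H].
    - rewrite Rabs_R0. apply Rmult_le_pos; [exact HM|apply Rlt_le, invsq_pos].
    - apply Hl, H. }
  exists (Pprod h J * exp (Series l')). split.
  - apply Rmult_integral_contrapositive. split; [|apply Rgt_not_eq, exp_pos].
    apply Pprod_neq_0. intros k _. unfold h. destruct (Nat.ltb k J); [apply Hg|lra].
  - apply is_lim_seq_ext_loc with (fun n => Pprod h J * exp (Psum l' n)).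
    + exists J. intros n Hn.
      rewrite (Pprod_exp g l' h n).
      * f_equal. induction Hn as [|n Hn IH]; [reflexivity|]. simpl. rewrite <- IH.
        unfold h at 3. destruct (Nat.ltb_spec n J); [lia|ring].
      * intros j _. unfold h, l'. destruct (Nat.ltb_spec j J) as [H|H]; [rewrite exp_0; ring|].
        rewrite (proj1 (Hl j H)). ring.
    + apply (is_lim_seq_scal_l _ (Pprod h J) (exp (Series l'))). apply lim_exp, Series_Psum, Ex.
Qed.

Lemma real_factor_product_converges (x : R) :
  (forall n, x <> - INR n) -> exists P, P <> 0 /\ is_lim_seq (Pprod (real_factor x)) P.
Proof.
  intros Hx. set (B := Rabs x + 1).
  assert (HB : 1 <= B) by (unfold B; pose proof (Rabs_pos x); lra).
  (* For [j >= 2 B + 1] every [c] with [|c| <= B] satisfies [c + j >= (j + 1)/2]. The base point 1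
     is used because all factors equal 1 there. *)
  destruct (nfloor_ex (2 * B + 1)) as [J0 HJ]; [lra|].
  apply infinite_product_converges with (l := log_ratio 1 x) (J := S J0) (M := B * ((B + 1) ^ 2 * 2)).
  - intros j. rewrite real_factor_eq. pose proof (pos_INR j).
    apply Rmult_integral_contrapositive. split; [|apply Rgt_not_eq, exp_pos].
    apply pow_nonzero. unfold Rdiv. apply Rmult_integral_contrapositive. split.
    + intros E. apply (Hx j). lra.
    + apply Rinv_neq_0_compat. lra.
  - intros j Hj. apply le_INR in Hj. rewrite S_INR in Hj.
    assert (Hpos : forall c, Rabs c <= B -> (INR j + 1) / 2 <= c + INR j).
    { intros c Hc. apply Rabs_le_between in Hc. lra. }
    assert (Bx : Rabs x <= B) by (unfold B; lra).
    assert (Hs : 0 < (x + INR j) * (1 + INR j)).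
    { specialize (Hpos x Bx). apply Rmult_lt_0_compat; lra. }
    split.
    + rewrite (real_factor_ratio x 1 j Hs).
      replace (real_factor 1 j) with 1; [ring|]. unfold real_factor.
      rewrite Rminus_diag. replace (0 ^ 2 / (2 * INR (S j)) - 0) with 0 by (unfold Rdiv; ring).
      rewrite exp_0. replace (1 + 0 / INR (S j)) with 1 by (unfold Rdiv; ring). rewrite pow1. ring.
    + destruct (log_ratio_mvt x 1 j Hs) as [c [Hc E]]. rewrite E.
      assert (Bc : Rabs c <= B).
      { apply Rabs_le. unfold B. pose proof (Rle_abs x). pose proof (Rle_abs (- x)). rewrite Rabs_Ropp in *.
        unfold Rmin, Rmax in Hc. destruct (Rle_dec 1 x); lra. }
      specialize (Hpos c Bc). pose proof (invsq_pos j) as Hi.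
      rewrite Rabs_mult, Rmult_assoc. apply Rmult_le_compat; try apply Rabs_pos.
      * unfold B. apply Rabs_le_between in Bx. unfold Rabs. destruct (Rcase_abs (x - 1)), (Rcase_abs x); lra.
      * unfold slope, sigma. apply Rabs_le_between in Bc. rewrite Rabs_mult, Rmult_assoc.
        apply Rmult_le_compat; try apply Rabs_pos.
        -- rewrite Rabs_pos_eq by apply pow2_ge_0. nra.
        -- unfold Rdiv. rewrite <- Rinv_mult, Rabs_pos_eq by (apply Rlt_le, Rinv_0_lt_compat; nra).
           replace (2 * invsq j) with (/ ((INR j + 1) * ((INR j + 1) / 2))) by (unfold invsq; field; lra).
           apply Rinv_le_contravar; [nra|]. apply Rmult_le_compat_l; lra.
Qed.

(** Quadratic remainder bounds can be summed over [j], so this criterion differentiates the series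
    of logarithms term by term. *)
Lemma is_derive_quadratic_remainder (f : R -> R) (y l K d : R) :
  0 < d -> 0 <= K ->
  (forall x, Rabs (x - y) < d -> Rabs (f x - f y - (x - y) * l) <= K * (x - y) ^ 2) -> is_derive f y l.
Proof.
  intros Hd HK H. apply is_derive_Reals. intros e He.
  assert (Hm : 0 < Rmin d (e / (K + 1))) by (apply Rmin_glb_lt; [exact Hd|apply Rdiv_lt_0_compat; lra]).
  exists (mkposreal _ Hm). intros h Hh0 Hh. simpl in Hh.
  assert (H1 : Rabs h < d) by (eapply Rlt_le_trans; [exact Hh|apply Rmin_l]).
  assert (H2 : Rabs h < e / (K + 1)) by (eapply Rlt_le_trans; [exact Hh|apply Rmin_r]).
  specialize (H (y + h)). replace (y + h - y) with h in H by ring. specialize (H H1).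
  pose proof (Rabs_pos_lt h Hh0) as Hp.
  replace ((f (y + h) - f y) / h - l) with ((f (y + h) - f y - h * l) / h) by (field; exact Hh0).
  unfold Rdiv. rewrite Rabs_mult, Rabs_inv.
  apply Rmult_lt_reg_r with (Rabs h); [exact Hp|].
  rewrite Rmult_assoc, Rinv_l, Rmult_1_r by lra.
  apply Rle_lt_trans with (1 := H).
  replace (h ^ 2) with (Rabs h * Rabs h) by (rewrite <- Rabs_mult, Rabs_pos_eq; [ring|nra]).
  apply (Rmult_lt_compat_r (K + 1)) in H2; [|lra].
  unfold Rdiv in H2. rewrite Rmult_assoc, Rinv_l, Rmult_1_r in H2 by lra. nra.
Qed.

Lemma barnes_real_derive (y : R) :
  (forall n, y <> - INR n) ->
  barnes_real y <> 0 /\ is_derive barnes_real y (barnes_real y * psiG_real y).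
Proof.
  intros Hn. destruct (off_poles_exists y Hn) as [d Hy]. pose proof Hy as [Hd Hdy].
  destruct (real_factor_product_converges y Hn) as [P [HP LP]].
  destruct (log_ratio_expansion y d Hy) as [K [HK Hexp]].
  pose proof (off_poles_away sigma y d Hy) as Ay.
  pose proof (ex_Ssum sigma 1 y d sigma_bound Ay) as Xy.
  set (T := (y - 1) ^ 2 * Ssum sigma y).
  set (Phi := fun x => Series (log_ratio y x)).
  assert (XT : ex_series (slope y)) by (apply (ex_series_scal_l ((y - 1) ^ 2) _ Xy)).
  assert (XR : forall x, Rabs (x - y) <= d / 2 -> ex_series (fun j => log_ratio y x j - (x - y) * slope y j)).
  { intros x Hx. apply ex_series_invsq_bound with (K * (x - y) ^ 2). intros j. apply Hexp, Hx. }
  assert (XL : forall x, Rabs (x - y) <= d / 2 -> ex_series (log_ratio y x)).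
  { intros x Hx. apply ex_series_ext with (fun j => (log_ratio y x j - (x - y) * slope y j) + (x - y) * slope y j).
    - intros j. change (log_ratio y x j - (x - y) * slope y j + (x - y) * slope y j = log_ratio y x j). ring.
    - apply (@ex_series_plus R_AbsRing R_NormedModule); [apply XR, Hx|apply (ex_series_scal_l (x - y) _ XT)]. }
  assert (Phi0 : Phi y = 0).
  { unfold Phi. rewrite (Series_ext _ (fun j => 0 * invsq j)); [rewrite Series_scal_l; ring|].
    intros j. pose proof (pos_INR j). unfold log_ratio.
    assert (y + INR j <> 0) by (intros E; specialize (Hdy j); rewrite E, Rabs_R0 in Hdy; lra).
    replace ((y + INR j) / (y + INR j)) with 1 by (field; assumption). rewrite ln_1. field. lra. }
  assert (DPhi : is_derive Phi y T).
  { apply is_derive_quadratic_remainder with (K := K * (PI ^ 2 / 6)) (d := d / 2); [lra| |].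
    - apply Rmult_le_pos; [exact HK|]. pose proof (pow2_ge_0 PI). lra.
    - intros x Hx. rewrite Phi0, Rminus_0_r.
      replace (Phi x - (x - y) * T) with (Series (fun j => log_ratio y x j - (x - y) * slope y j)).
      + replace (K * (PI ^ 2 / 6) * (x - y) ^ 2) with (K * (x - y) ^ 2 * (PI ^ 2 / 6)) by ring.
        apply Series_invsq_bound. intros j. apply Hexp. lra.
      + rewrite Series_minus; [|apply XL; lra|apply (ex_series_scal_l (x - y) _ XT)].
        rewrite Series_scal_l. unfold slope. rewrite Series_scal_l. reflexivity. }
  (* Since the logarithms are taken relative to [y], the product near [y] is its nonzero value [P]
     at [y] times [exp (Phi x)], whatever the sign of [P]; differentiating this form yields the
     logarithmic derivative. *)
  assert (Loc : forall x, Rabs (x - y) <= d / 2 -> barnes_real x =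
    exp ((x - 1) / 2 * ln (2 * PI)) * exp (- ((x - 1) + (1 + euler_gamma) * (x - 1) ^ 2) / 2) * (P * exp (Phi x))).
  { intros x Hx. unfold barnes_real. f_equal.
    rewrite (is_lim_seq_unique (Pprod (real_factor x)) (P * exp (Phi x))); [reflexivity|].
    apply is_lim_seq_ext with (fun n => Pprod (real_factor y) n * exp (Psum (log_ratio y x) n)).
    - intros n. symmetry. apply Pprod_exp. intros j _. apply real_factor_ratio.
      apply off_poles_same_sign with d; assumption.
    - apply is_lim_seq_mult'; [exact LP|]. apply lim_exp, Series_Psum, XL, Hx. }
  assert (Hyy : Rabs (y - y) <= d / 2) by (rewrite Rminus_diag, Rabs_R0; lra).
  split.
  - rewrite (Loc y Hyy). repeat apply Rmult_integral_contrapositive_currified; try apply Rgt_not_eq, exp_pos. exact HP.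
  - apply is_derive_ext_loc with (fun x => exp ((x - 1) / 2 * ln (2 * PI)) *
       exp (- ((x - 1) + (1 + euler_gamma) * (x - 1) ^ 2) / 2) * (P * exp (Phi x))).
    + assert (Hd2 : 0 < d / 2) by lra. exists (mkposreal _ Hd2). intros x Hx.
      symmetry. apply Loc. apply Rlt_le, Hx.
    + rewrite (Loc y Hyy).
      auto_derive; [exists T; exact DPhi|].
      change (Derive (fun x => Phi x) y) with (Derive Phi y).
      rewrite (is_derive_unique _ _ _ DPhi). unfold psiG_real. fold T.
      change ((y - 1) ^ 2) with ((y + - (1)) * ((y + - (1)) * 1)). unfold Rminus, Rdiv.
      set (e1 := exp ((y + - (1)) * / 2 * ln (2 * PI))).
      set (e2 := exp (- (y + - (1) + (1 + euler_gamma) * ((y + - (1)) * ((y + - (1)) * 1))) * / 2)).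
      field.
Qed.

(** * From the complex definition of [psiG] to the real line *)

Lemma C_derive_RtoC (f : C -> C) (g : R -> R) (y l : R) :
  (forall x, f (RtoC x) = RtoC (g x)) -> is_derive g y l -> C_derive f (RtoC y) = RtoC l.
Proof.
  intros Hf Hg.
  assert (E : forall x, x <> y -> ((f (x, 0)%R - f (RtoC y)) / ((x, 0)%R - RtoC y))%C = RtoC ((g x - g y) / (x - y))).
  { intros x Hx. change (x, 0)%R with (RtoC x). rewrite !Hf, <- !RtoC_minus, <- RtoC_div by lra. reflexivity. }
  unfold C_derive, C_lim. apply injective_projections.
  - assert (L : is_lim (fun x => fst ((f (x, 0)%R - f (RtoC y)) / ((x, 0)%R - RtoC y))%C) y l).
    { apply is_lim_spec. intros e. apply is_derive_Reals in Hg.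
      destruct (Hg e (cond_pos e)) as [d Hd]. exists d. intros x Hx Hxy.
      rewrite E by exact Hxy. simpl.
      change R in x.
      specialize (Hd (x - y) ltac:(lra) Hx). replace (y + (x - y)) with x in Hd by ring. exact Hd. }
    exact (f_equal real (is_lim_unique _ _ _ L)).
  - assert (L : is_lim (fun x => snd ((f (x, 0)%R - f (RtoC y)) / ((x, 0)%R - RtoC y))%C) y 0).
    { apply is_lim_spec. intros e. exists (mkposreal 1 Rlt_0_1). intros x Hx Hxy.
      rewrite E by exact Hxy. simpl. rewrite Rminus_diag, Rabs_R0. apply cond_pos. }
    exact (f_equal real (is_lim_unique _ _ _ L)).
Qed.

Lemma psiG_zero_RtoC (y : R) :
  psiG_zero (RtoC y) <-> (forall n, y <> - INR n) /\ psiG_real y = 0.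
Proof.
  assert (N : ~ nonpos_int (RtoC y) <-> forall n, y <> - INR n).
  { split.
    - intros H n E. apply H. exists n. rewrite E. reflexivity.
    - intros H [n E]. apply (H n). apply RtoC_inj, E. }
  unfold psiG_zero. rewrite N.
  split; intros [Hn H]; (split; [exact Hn|]); destruct (barnes_real_derive y Hn) as [H0 HD];
    unfold psiG in *; rewrite (C_derive_RtoC _ _ _ _ BarnesG_RtoC HD), BarnesG_RtoC in *;
    rewrite <- RtoC_div in * by exact H0.
  - apply RtoC_inj in H. rewrite <- H. field. exact H0.
  - rewrite H. f_equal. field. exact H0.
Qed.

(** * The decreasing enumeration of the zeros *)

Lemma decreasing_le (a : nat -> R) (m n : nat) :
  (forall k, a (S k) < a k) -> (m <= n)%nat -> a n <= a m.
Proof. intros H Hmn. induction Hmn as [|n _ IH]; [lra|]. specialize (H n). lra. Qed.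

(** Strong induction: if the values agree below [n] and [a n = b m], then [m < n] would give
    [a n = a m], so [m >= n] and [a n <= b n]; the reverse inequality is symmetric. *)
Lemma decreasing_enumeration_unique (a b : nat -> R) :
  (forall k, a (S k) < a k) -> (forall k, b (S k) < b k) ->
  (forall k, exists m, a k = b m) -> (forall k, exists m, b k = a m) -> forall n, a n = b n.
Proof.
  intros Ha Hb Hab Hba n. induction n as [n IH] using (well_founded_induction Wf_nat.lt_wf).
  assert (X : forall u v : nat -> R, (forall k, u (S k) < u k) -> (forall k, v (S k) < v k) ->
     (forall m, (m < n)%nat -> u m = v m) -> (exists m, u n = v m) -> u n <= v n).
  { intros u v Hu Hv Huv [m Hm]. destruct (Nat.lt_ge_cases m n) as [H|H].
    - rewrite <- (Huv m H) in Hm. pose proof (decreasing_le u (S m) n Hu H). specialize (Hu m). lra.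
    - rewrite Hm. apply decreasing_le; assumption. }
  apply Rle_antisym; apply X; auto. intros m Hm. symmetry. apply IH, Hm.
Qed.

Lemma Ssum_pos (rho : nat -> R) (M z : R) :
  harmonic_bound rho M -> (forall j, 0 < rho j) -> 0 < z -> 0 < Ssum rho z.
Proof.
  intros Hr Hp Hz.
  assert (Hj : forall j, 0 < rho j / (z + INR j)).
  { intros j. pose proof (pos_INR j). apply Rdiv_lt_0_compat; [apply Hp|lra]. }
  apply Rlt_le_trans with (Psum (fun j => rho j / (z + INR j)) 1).
  - simpl. specialize (Hj O). simpl in Hj. lra.
  - apply Psum_le_Series; [intros j; apply Rlt_le, Hj|].
    apply ex_Ssum with M z; [exact Hr|apply pos_away, Hz].
Qed.

Definition zeros (p q : R) (n : nat) : R :=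
  match n with
  | O => p
  | S O => q
  | S (S k) => gap_root (residue p q) k
  end.

Lemma residue_gap_root (p q : R) (k : nat) :
  1 < p -> 1 < q ->
  gap k (gap_root (residue p q) k) /\ Ssum (residue p q) (gap_root (residue p q) k) = 0.
Proof. intros Hp Hq. apply gap_root_spec with 1; [apply residue_bound; lra| |]; apply residue_pos; lra. Qed.

Lemma zeros_decreasing (p q : R) (n : nat) : 1 < q < p -> zeros p q (S n) < zeros p q n.
Proof.
  intros Hpq. destruct n as [|[|k]]; simpl; [lra| |].
  - destruct (residue_gap_root p q 0 ltac:(lra) ltac:(lra)) as [[_ H] _]. simpl in H. lra.
  - apply gap_lt with k (S k); [lia| |]; apply residue_gap_root; lra.
Qed.

Lemma psiG_zero_iff_zeros (p q y : R) :
  1 < q < p -> psiG_real p = 0 -> psiG_real q = 0 ->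
  psiG_zero (RtoC y) <-> exists n, y = zeros p q n.
Proof.
  intros Hpq p_root q_root.
  assert (Hpos : forall x, 0 < x -> forall n, x <> - INR n) by (intros x Hx n; pose proof (pos_INR n); lra).
  rewrite psiG_zero_RtoC. split.
  - intros [Hn H0]. destruct (off_poles_exists y Hn) as [d [Hd Hy]].
    rewrite (psiG_real_factor p q y d) in H0 by (assumption || lra).
    apply Rmult_integral in H0. destruct H0 as [H0|H0].
    + apply Rmult_integral in H0. destruct H0 as [H0|H0]; [exists O|exists 1%nat]; simpl; lra.
    + destruct (Rlt_le_dec 0 y) as [Py|Ny].
      (* To the right of 0 every fraction of [S] is positive, so [p] and [q] are the only positive
         zeros. *)
      * exfalso. pose proof (Ssum_pos (residue p q) 1 y (residue_bound p q ltac:(lra) ltac:(lra))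
          (fun j => residue_pos p q j ltac:(lra) ltac:(lra)) Py). lra.
      * destruct (nfloor_ex (- y)) as [k Hk]; [lra|].
        assert (G : gap k y) by (unfold gap; specialize (Hn k); lra).
        exists (S (S k)). simpl. destruct (residue_gap_root p q k ltac:(lra) ltac:(lra)) as [G' E'].
        apply gap_root_unique with (residue p q) 1 k; try assumption.
        -- apply residue_bound; lra.
        -- intros j. apply Rlt_le, residue_pos; lra.
        -- apply residue_pos; lra.
  - intros [n ->]. destruct n as [|[|k]]; simpl.
    + split; [apply Hpos; lra|exact p_root].
    + split; [apply Hpos; lra|exact q_root].
    + destruct (residue_gap_root p q k ltac:(lra) ltac:(lra)) as [G E].
      pose proof (fun n => gap_off_integers k _ n G) as Hn. split; [exact Hn|].
      destruct (off_poles_exists _ Hn) as [d [Hd Hy]].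
      rewrite (psiG_real_factor p q _ d) by (assumption || lra). rewrite E. ring.
Qed.

Lemma zeros_power_sum (p q : R) :
  1 < p -> 1 < q ->
  is_series (fun n => / zeros p q n ^ 2) (/ p ^ 2 + / q ^ 2 + power_sum (residue p q) + PI ^ 2 / 6).
Proof.
  intros Hp Hq. apply is_series_Psum.
  apply is_lim_seq_incr_1. apply is_lim_seq_incr_1.
  apply is_lim_seq_ext with
    (fun n => (/ p ^ 2 + / q ^ 2) + Psum (fun k => / gap_root (residue p q) k ^ 2) n).
  - intros n. rewrite !Psum_incr_1. simpl. ring.
  - rewrite Rplus_assoc. apply is_lim_seq_plus'; [apply is_lim_seq_const|].
    apply is_series_Psum, gap_roots_power_sum with 1; [apply residue_bound; lra|].
    intros j. apply residue_pos; lra.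
Qed.

Theorem mainTheorem7 (beta : nat -> R)
  (beta_decr : forall k : nat, beta (S k) < beta k)
  (beta_zeros : forall z : C, psiG_zero z <-> exists k : nat, z = RtoC (beta k)) :
  is_series (fun k : nat => 1 / (beta k) ^ 2)
    (9 / 4 + PI ^ 2 / 2
     + euler_gamma * (1 + euler_gamma + ln (2 * PI))
     - 1 / 2 * ln (2 * PI)
     + 1 / 4 * (ln (2 * PI)) ^ 2).
Proof.
  destruct psiG_real_roots as (p & q & Hq & Hp & Ep & Eq).
  assert (Hpq : 1 < q < p) by lra.
  assert (E : forall n, beta n = zeros p q n).
  { apply decreasing_enumeration_unique.
    - exact beta_decr.
    - intros n. apply zeros_decreasing, Hpq.
    (* [beta] and [zeros p q] enumerate the same set of real zeros, each in decreasing order, so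
       they coincide index by index. *)
    - intros k. apply (psiG_zero_iff_zeros p q _ Hpq Ep Eq). apply beta_zeros. exists k. reflexivity.
    - intros k.
      destruct (proj1 (beta_zeros (RtoC (zeros p q k)))) as [m Hm].
      + apply (psiG_zero_iff_zeros p q _ Hpq Ep Eq). exists k. reflexivity.
      + exists m. apply RtoC_inj, Hm. }
  apply is_series_ext with (fun n => / zeros p q n ^ 2).
  { intros n. rewrite E. symmetry. apply Rmult_1_l. }
  pose proof (zeros_power_sum p q ltac:(lra) ltac:(lra)) as S.
  rewrite (power_sum_residue p q ltac:(lra) ltac:(lra) ltac:(lra) Ep Eq) in S.
  match goal with |- is_series _ ?l => replace l with
    (((ln (2 * PI) - 1) / 2 + euler_gamma) ^ 2 + 2 * (1 + euler_gamma + PI ^ 2 / 6) + PI ^ 2 / 6) by field end.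
  exact S.
Qed.
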